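(* Let $1\le\delta<2$ and let $\ell$ be a constant positive integer. Then $$\alpha_{\star}(\delta,\ell)\;\le\;\min_{\beta\in\Delta_{\ell-1}}\ \max_{i\in\{1,\dots,\ell\}}\ \frac{2 f\left(\sum_{j=1}^{i}\beta_j,\ \delta\right)}{\sum_{j=i}^{\ell}\beta_j}.$$ In particular, for every $1\le\delta<2$ and every constant positive integer $\ell$ there exists $\beta\in\Delta_{\ell-1}$ such that $$\max_{i\in\{1,\dots,\ell\}}\ \frac{2 f\left(\sum_{j=1}^{i}\beta_j,\ \delta\right)}{\sum_{j=i}^{\ell}\beta_j}\;\le\; 2-\delta\left(\frac{2-\delta}{2}\right)^{\ell},$$ and hence $$\alpha_{\star}(\delta,\ell)\le 2-\delta\left(\frac{2-\delta}{2}\right)^{\ell}.$$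
   Context: For $0\le\beta\le1$ and $1\le\delta<2$ define $$f(\beta,\delta):=\begin{cases}(2-\delta)\sqrt{1-\beta}+\delta-1, & \beta\in[0,\frac{16}{25}],\\ 1-\left(1-\frac{\delta}{2}\right)\sqrt{\beta}, & \beta\in[\frac{16}{25},1]\end{cases}$$ (the two expressions agree at $\beta=\frac{16}{25}$). $\Delta_{\ell-1}=\{(\beta_1,\dots,\beta_\ell): \beta_j\ge0,\ \sum_{j=1}^\ell\beta_j=1\}$ is the $(\ell-1)$-simplex. A quotient whose denominator $\sum_{j=i}^{\ell}\beta_j$ is $0$ is interpreted as $+\infty$ (the numerator is always positive). All logarithms are in base $2$. $G_{n,\frac12}$ denotes the random graph on vertex set $V=\{1,\dots,n\}$ in which each of the $\binom n2$ pairs of vertices is an edge independently with probability $\frac12$. Probe model with $\ell$ rounds. An algorithm has unbounded computation time and accesses the input graph $G$ only by probes; a probe of a pair $(i,j)$, $1\le i<j\le n$, reveals whether $(i,j)$ is an edge of $G$. The algorithm proceeds in $\ell$ rounds: in round $1$ it selects a set $E_1$ of pairs and the status (edge or non-edge) of all pairs in $E_1$ is revealed; for $2 \le i\le \ell$, in round $i$ it selects a set $E_i$ of pairs, depending on the outcomes of the probes in rounds $1,\dots,i-1$, and the status of all pairs in $E_i$ is revealed. All probes of one round are done in parallel. After round $\ell$ the algorithm outputs a set of vertices, which it has to ensure is a clique of $G$. The total number of probes is $\sum_{i=1}^{\ell}|E_i|$. $\alpha_{\star}(\delta,\ell)$ is the supremum over all $\alpha$ such that there exists an algorithm (one for each $n$)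 that, on a graph drawn at random from $G_{n,\frac12}$, probes at most $n^{\delta}$ entries of the adjacency matrix, with the probes being done in $\ell$ rounds, and outputs a clique of size at least $\alpha\log n$ with probability at least $\frac12$, for all sufficiently large $n$. *)

(* Defs.v *)
From HB Require Import structures.
From mathcomp Require Import all_boot all_order all_algebra.
From mathcomp Require Import all_classical all_reals all_analysis.
Set Implicit Arguments.
Unset Strict Implicit.
Unset Printing Implicit Defensive.
Import Order.TTheory GRing.Theory Num.Theory.
Import numFieldNormedType.Exports.
Local Open Scope classical_set_scope.
Local Open Scope ring_scope.

(* Vertices are numbered 0, ..., n-1; an unordered pair is stored increasingly. *)
Definition vpair (n : nat) := {p : 'I_n * 'I_n | (p.1 < p.2)%N}.

Definition graph (n : nat) := {ffun vpair n -> bool}.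

Definition is_clique (n : nat) (G : graph n) (S : {set 'I_n}) : Prop :=
  forall e : vpair n, (val e).1 \in S -> (val e).2 \in S -> G e.

Definition Gnp_weight (R : realType) (n : nat) (p : R) (G : graph n) : R :=
  \prod_(e : vpair n) (if G e then p else 1 - p).

Definition Gnp_prob (R : realType) (n : nat) (p : R) (A : pred (graph n)) : R :=
  \sum_(G : graph n | A G) Gnp_weight p G.

(* What one round of parallel probes reveals: [Some b] on a probed pair, where
   [b] says whether it is an edge, and [None] on a pair that was not probed. *)
Definition answer (n : nat) := {ffun vpair n -> option bool}.

Definition reveal (n : nat) (G : graph n) (E : {set vpair n}) : answer n :=
  [ffun e => if e \in E then Some (G e) else None].

(* Both fields are arbitrary functions of the list of answers received in the
   rounds completed so far, oldest first; the number of the current round can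
   be read off the length of the list. *)
Record algorithm (n : nat) := Algorithm {
  select : seq (answer n) -> {set vpair n};
  output : seq (answer n) -> {set 'I_n}
}.

Fixpoint transcript (n : nat) (A : algorithm n) (G : graph n) (k : nat)
    : seq (answer n) :=
  if k is k'.+1 then
    let t := transcript A G k' in rcons t (reveal G (select A t))
  else [::].

(* With rounds numbered from 0, the set probed in round [i] is selected from
   the answers of rounds 0, ..., i-1. *)
Definition num_probes (n : nat) (A : algorithm n) (l : nat) (G : graph n)
    : nat :=
  (\sum_(i < l) #|select A (transcript A G i)|)%N.

Definition result (n : nat) (A : algorithm n) (l : nat) (G : graph n)
    : {set 'I_n} :=
  output A (transcript A G l).

Definition log2 (R : realType) (x : R) : R := ln x / ln 2.

Definition achievable (R : realType) (delta : R) (l : nat) (alpha : R) : Prop :=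
  exists A : forall n : nat, algorithm n,
    \forall n \near \oo,
      [/\ forall G, (num_probes (A n) l G)%:R <= n%:R `^ delta,
          forall G, is_clique G (result (A n) l G)
        & 2^-1 <= Gnp_prob (2^-1 : R)
            (fun G => alpha * log2 n%:R <= #|result (A n) l G|%:R)].

(* Taken in the extended reals, so that no boundedness is presupposed. *)
Definition alpha_star (R : realType) (delta : R) (l : nat) : \bar R :=
  ereal_sup [set alpha%:E | alpha in [set a | achievable delta l a]].

Definition f (R : realType) (beta delta : R) : R :=
  if beta <= 16 / 25 then (2 - delta) * Num.sqrt (1 - beta) + delta - 1
  else 1 - (1 - delta / 2) * Num.sqrt beta.

Definition simplex (R : realType) (l : nat) : set 'rV[R]_l :=
  [set beta | (forall j, 0 <= beta 0 j) /\ \sum_(j < l) beta 0 j = 1].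

Definition round_ratio (R : realType) (l : nat) (delta : R) (beta : 'rV[R]_l)
    (i : 'I_l) : \bar R :=
  let den := \sum_(j < l | (i <= j)%N) beta 0 j in
  if den == 0 then +oo%E
  else (2 * f (\sum_(j < l | (j <= i)%N) beta 0 j) delta / den)%:E.

Definition max_ratio (R : realType) (l : nat) (delta : R) (beta : 'rV[R]_l)
    : \bar R :=
  \big[maxe/-oo%E]_(i < l) round_ratio delta beta i.

Definition is_minimum (R : realType) (T : Type) (D : set T) (g : T -> \bar R)
    (m : \bar R) : Prop :=
  (exists2 x, D x & g x = m) /\ (forall x, D x -> (m <= g x)%E).

(* Main.v *)
Require Import Defs.
From HB Require Import structures.
From mathcomp Require Import all_boot all_order all_algebra.
From mathcomp Require Import all_classical all_reals all_analysis.
From mathcomp Require Import ring lra zify.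
Set Implicit Arguments.
Unset Strict Implicit.
Unset Printing Implicit Defensive.
Import Order.TTheory GRing.Theory Num.Theory.
Import numFieldNormedType.Exports.
Local Open Scope classical_set_scope.
Local Open Scope ring_scope.

(** Write [B j] for the sum of the first [j] coordinates of a point [beta] of
    the simplex.  For every such [beta] the largest of the ratios
    [2 f (B i.+1) / (1 - B i)] bounds [alpha], for the following reason.

    Suppose that the output contains a set [S] of [k = floor (alpha log n)]
    vertices.  An algorithm that always outputs a clique has probed all pairs
    of [S]: changing an unprobed pair would leave the output unchanged
    ([result_probed]).  Let [i] be the first round after which the proportion
    of probed pairs of [S] is at least [B i.+1].  At the start of that round
    the proportion was at most [B i], so at least [1 - B i] of the pairs of
    [S] are probed in round [i] or later, and all of them are edges.  The
    pairs probed up to and including round [i] are determined by the answers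
    of the earlier rounds, and they form a graph with at most [n ^ delta]
    edges in which [S] has density at least [B i.+1].  Such a graph has at
    most [n ^ (f (B i.+1) k + o(k))] sets of [k] vertices of that density
    ([card_dense_sets]), and each survives the later rounds with probability
    at most [2 ^ (- (1 - B i) k (k - 1) / 2)] ([card_fresh_present]).  If
    [alpha] exceeds the ratio for each [i], these products tend to [0], and so
    does the probability of success ([achievable_le]).

    The heart is the bound on the number of dense sets of a graph with few
    edges, proved in the manner of Kraft's inequality.  List a set vertex by
    vertex, and give a new vertex [v] one of the weights [1 / n],
    [deg v / D] with [D] a bound on the sum of all degrees, or [1 / deg u]
    for an earlier neighbour [u].  Each kind of weight sums to at most [1] over
    the possible [v], so the total weight of all lists of length [k] is at
    most [(k + 1)!], and it suffices to list each dense set with large weight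
    ([heavy_enumeration]).  Put [q = sqrt D].  Vertices of degree at least [q]
    are listed first by their degree; a low vertex with a low neighbour in
    the set costs a factor [q] on average; a remaining low vertex costs
    the smallest degree of its neighbours in the set, or [n].  Comparing these
    costs level by level shows that the weight is at least
    [q ^ (- k) (n / q) ^ (- u)], where [u] is the largest
    value of [|A| - |B|] over disjoint subsets [A] and [B] of the set such that
    [A] has all its neighbours in [B] ([prod_le_of_tails]).  Few edges are left when
    [|A| - |B|] is large, and the optimum is attained by one of two shapes: [B]
    complete to everything and [A] its complement, or [B] empty and a clique
    outside [A].  This maximum is [surplus], and the two shapes are the two
    branches of [f] ([f_surplusE]).

    The minimum over the simplex exists since the largest ratio is continuous
    where the last coordinate is bounded away from [0] and is large elsewhere
    ([max_ratio_minimum]).  The explicit bound replaces [f] by the linear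
    function [1 - (1 - delta / 2) beta], which is at least [f], and equalizes
    all ratios but the first, which amounts to a linear recurrence for the
    tails of [beta] ([explicit_profile]). *)

(** * Optimizing the exponent *)

(** The largest value of [(|A| - |B|) / k], up to lower order terms, for a set
    of [k] vertices of density [beta] in which all neighbours of [A] are in
    [B]. *)
Definition surplus (R : realType) (beta : R) : R :=
  Num.max (2 * Num.sqrt (1 - beta) - 1) (1 - Num.sqrt beta).

(** In a graph with [n ^ delta] edges each vertex of a [k]-set costs
    [n ^ (delta / 2)], except for a surplus of vertices that cost [n].  The
    two branches of [f] come from the two terms of [surplus], which cross
    where [sqrt (1 - beta) = 1 - sqrt beta / 2], that is at [16 / 25]. *)
Lemma f_surplusE (R : realType) (beta delta : R) :
  0 <= beta <= 1 -> delta <= 2 ->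
  f beta delta = delta / 2 + (1 - delta / 2) * surplus beta.
Proof.
move=> /andP[b0 b1] d2; rewrite /f /surplus.
have c0 : 0 <= 1 - beta by lra.
set s := Num.sqrt (1 - beta); set r := Num.sqrt beta.
have s0 : 0 <= s by apply: sqrtr_ge0.
have r0 : 0 <= r by apply: sqrtr_ge0.
have s2 : s * s = 1 - beta by rewrite -expr2 sqr_sqrtr.
have r2 : r * r = beta by rewrite -expr2 sqr_sqrtr.
case: ifP => [h|/negbT]; last rewrite -ltNge => h.
- have r45 : r <= 4 / 5 by nra.
  have : 1 - r <= 2 * s - 1.
    rewrite leNgt; apply/negP => lt.
    have : s * s < (1 - r / 2) * (1 - r / 2) by apply: ltr_pM => //; lra.
    have : 0 <= r * (4 / 5 - r) by rewrite mulr_ge0 //; lra.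
    nra.
  by move=> ?; rewrite max_l //; lra.
- have r45 : 4 / 5 < r by nra.
  have : 2 * s - 1 <= 1 - r.
    rewrite leNgt; apply/negP => lt.
    have r1 : r <= 1 by nra.
    have : (1 - r / 2) * (1 - r / 2) < s * s by apply: ltr_pM => //; lra.
    have : 0 <= r * (r - 4 / 5) by rewrite mulr_ge0 //; lra.
    nra.
  by move=> ?; rewrite max_r //; lra.
Qed.

Lemma surplus_ge0 (R : realType) (beta : R) : beta <= 1 -> 0 <= surplus beta.
Proof.
move=> b1; rewrite /surplus le_max; apply/orP; right.
by rewrite subr_ge0 -sqrtr1 ler_wsqrtr.
Qed.

Lemma f_ge0 (R : realType) (beta delta : R) :
  0 <= beta <= 1 -> 0 <= delta <= 2 -> 0 <= f beta delta.
Proof.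
move=> b01 /andP[d0 d2]; rewrite f_surplusE //.
have /andP[_ b1] := b01; have s0 := surplus_ge0 b1.
by rewrite addr_ge0 ?mulr_ge0 //; lra.
Qed.

(** With [a] and [b] the proportions of [A] and [B], the pairs inside [A] or
    from [A] to the complement of [B] are non-edges, which is the constraint
    [2 a - a ^ 2 - 2 a b <= 1 - beta], up to the error [eta] due to the
    diagonal.  For a fixed difference [w = a - b] the left side is concave in
    [a], so that it is smallest at the ends [a = w] (no [B]) and
    [a = (1 + w) / 2] ([A] and [B] cover everything).  These give the two terms
    of [surplus]. *)
Lemma surplus_optimal (R : realType) (beta eta a b : R) :
  0 <= beta <= 1 -> 0 <= eta -> 0 <= a -> 0 <= b -> a + b <= 1 ->
  2 * a - a ^+ 2 - 2 * a * b <= 1 - beta + eta ->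
  a - b <= surplus beta + 2 * Num.sqrt eta.
Proof.
move=> /andP[b0 b1] e0 a0 b0' ab1 hab; rewrite leNgt; apply/negP.
rewrite /surplus; have c0 : 0 <= 1 - beta by lra.
set s := Num.sqrt (1 - beta); set r := Num.sqrt beta; set t := Num.sqrt eta.
have s0 : 0 <= s by apply: sqrtr_ge0.
have r0 : 0 <= r by apply: sqrtr_ge0.
have t0 : 0 <= t by apply: sqrtr_ge0.
have s2 : s * s = 1 - beta by rewrite -expr2 sqr_sqrtr.
have r2 : r * r = beta by rewrite -expr2 sqr_sqrtr.
have t2 : t * t = eta by rewrite -expr2 sqr_sqrtr.
rewrite -ltrBrDr gt_max => /andP[h1 h2].
set w := a - b in h1 h2.
have bE : b = a - w by rewrite /w; lra.
have wa : w <= a by rewrite /w; lra.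
have aw : 2 * a <= 1 + w by rewrite /w; lra.
have w1 : w <= 1 by rewrite /w; lra.
have tr : t < r by lra.
have w0 : 0 <= w by nra.
have hs : s + t < (1 + w) / 2 by lra.
have e1 : 1 - beta + eta < ((1 + w) / 2) ^+ 2.
  have : (s + t) ^+ 2 < ((1 + w) / 2) ^+ 2 by rewrite ltrXn2r ?nnegrE //; lra.
  by nra.
have e2 : 1 - beta + eta < 1 - (1 - w) ^+ 2.
  have : (1 - w) ^+ 2 < (r - t) ^+ 2 by rewrite ltrXn2r ?nnegrE //; lra.
  by nra.
move: hab; rewrite leNgt => /negP; apply.
rewrite bE.
(* A concave quadratic in [a] exceeds its chord over [w, (1 + w) / 2] by a
   multiple of this product. *)
have : 0 <= (a - w) * ((1 + w) / 2 - a) by rewrite mulr_ge0 //; lra.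
nra.
Qed.

(** * Comparing products through counts of large factors *)

(** If at each level [t] there are at most [U] more factors [x >= t] than
    factors [z >= t], all but [U] of the [x] can be matched with a [z] at least as large,
    and the unmatched ones are at most [Q].  The matching proceeds from the
    smallest elements upwards: a [z] below the smallest [x] is discarded,
    otherwise the two smallest elements are matched. *)
Lemma prod_le_of_tails (R : realType) (Q U : R) (xs zs : seq R) :
  1 <= Q -> 0 <= U -> sorted <=%R xs -> sorted <=%R zs ->
  all (fun x => 1 <= x <= Q) xs -> all (fun z => 1 <= z) zs ->
  (forall t, t \in xs ->
     (count (fun x => t <= x) xs)%:R <= U + (count (fun z => t <= z) zs)%:R) ->
  \prod_(x <- xs) x <= Q `^ U * \prod_(z <- zs) z.
Proof.
move=> Q1 U0; have Q0 : 0 < Q by lra.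
have prod1 (s : seq R) : all (fun z => 1 <= z) s -> 1 <= \prod_(z <- s) z.
  elim: s => [|z s IH] /=; first by rewrite big_nil.
  by move=> /andP[z1 /IH ?]; rewrite big_cons; nra.
have small (xs' : seq R) : all (fun x => 1 <= x <= Q) xs' ->
    (size xs')%:R <= U -> \prod_(x <- xs') x <= Q `^ U.
  move=> ax szU; apply: (@le_trans _ _ (Q ^+ size xs')).
    elim: xs' ax {szU} => [|x xs' IH] /=; first by rewrite big_nil.
    move=> /andP[/andP[x1 xQ] ax]; rewrite big_cons exprS.
    apply: ler_pM; [by lra| |by []|exact: IH].
    apply: le_trans (prod1 _ _) => //.
    by apply: sub_all ax => y /andP[].
  by rewrite -(powR_mulrn _ (ltW Q0)) ler_powR.
have QU1 : 1 <= Q `^ U.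
  by have := ler_powR Q1 U0; rewrite powRr0.
have call (x : R) s : path <=%R x s -> count (fun y => x <= y) s = size s.
  by rewrite (path_sortedE le_trans) => /andP[+ _]; rewrite all_count => /eqP.
elim: zs xs => [|z zs IH] [|x xs] sx sz ax az hc.
- by rewrite !big_nil mulr1.
- rewrite big_nil mulr1; apply: small => //.
  by have := hc x (mem_head _ _); rewrite /= lexx addr0 call.
- by rewrite big_nil mulr_ege1 // prod1.
have Hx := hc x (mem_head _ _).
move: Hx; rewrite [count _ (x :: xs)]/= lexx (call _ _ sx) => Hx.
have /= /andP[z1 az'] := az; have sz' : sorted <=%R zs by exact: path_sorted sz.
have /= /andP[/andP[x1 xQ] ax'] := ax.
have sx' : sorted <=%R xs by exact: path_sorted sx.
have P1 := prod1 _ az'.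
have QU : 0 < Q `^ U by rewrite powR_gt0.
(* [z] is the smallest of the [zs] and [x] the smallest of the [xs]. *)
case: (ltP z x) => zx.
  apply: (@le_trans _ _ (Q `^ U * \prod_(z <- zs) z)).
    apply: IH => // t tx.
    have := hc t tx; rewrite [count _ (z :: zs)]/=.
    have : x <= t.
      move: tx sx; rewrite inE /= (path_sortedE le_trans).
      by case/orP => [/eqP -> //|tx /andP[/allP /(_ _ tx)]].
    move=> xt; have -> : (t <= z) = false by apply/negbTE; rewrite -ltNge; lra.
    by [].
  rewrite ler_pM2l // big_cons; nra.
rewrite !big_cons mulrCA.
have PX : 0 <= \prod_(x <- xs) x.
  apply: le_trans (prod1 _ _) => //.
  by apply: sub_all ax' => y /andP[].
apply: ler_pM => //; first by lra.
apply: IH => // t tx.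
have := hc t; rewrite inE tx orbT => /(_ isT) /=.
case: (leP t z) => tz.
  move=> _; apply: (@le_trans _ _ (size xs)%:R); first by rewrite ler_nat count_size.
  have -> : count (fun z => t <= z) zs = size zs.
    move: sz; rewrite /= (path_sortedE le_trans) => /andP[/allP az2 _].
    by apply/eqP; rewrite -all_count; apply/allP => y /az2; apply: le_trans.
  move: Hx; rewrite /= -!natr1.
  have : (count (fun y => x <= y) zs)%:R <= (size zs)%:R :> R.
    by rewrite ler_nat count_size.
  case: (x <= z); rewrite /= ?natrD /=; lra.
have -> : (t <= x) = false by apply/negbTE; rewrite -ltNge; lra.
by rewrite !add0n.
Qed.

(** * Weighted enumerations of vertex sets *)

Definition degree (T : finType) (e : rel T) (v : T) : nat :=
  #|[set u | e v u]%SET|.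

(** Three ways of naming [v] when the vertices of [s] are known: as an
    arbitrary vertex, as the end of an edge, and as a neighbour of some [u] in
    [s].  Each is a subprobability distribution on [v]. *)
Definition extension_weight (R : realType) (T : finType) (e : rel T) (D : R)
    (s : seq T) (v : T) : R :=
  #|T|%:R^-1 + (degree e v)%:R / D
  + \sum_(u <- s) (e u v)%:R / (degree e u)%:R.

(** The most recently listed vertex is the head of the sequence. *)
Fixpoint weight (R : realType) (T : finType) (e : rel T) (D : R)
    (s : seq T) : R :=
  if s is v :: s' then extension_weight e D s' v * weight e D s' else 1.

Lemma extension_weight_ge0 (R : realType) (T : finType) (e : rel T) (D : R)
    (s : seq T) (v : T) : 0 <= D -> 0 <= extension_weight e D s v.
Proof.
move=> D0; rewrite /extension_weight !addr_ge0 ?invr_ge0 ?ler0n //.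
  by rewrite divr_ge0.
by apply: sumr_ge0 => u _; rewrite divr_ge0.
Qed.

Lemma weight_ge0 (R : realType) (T : finType) (e : rel T) (D : R) (s : seq T) :
  0 <= D -> 0 <= weight e D s.
Proof.
by move=> D0; elim: s => //= v s IH; rewrite mulr_ge0 // extension_weight_ge0.
Qed.

Lemma sum_extension_weight (R : realType) (T : finType) (e : rel T) (D : R)
    (s : seq T) :
  0 < D -> (\sum_v degree e v)%:R <= D ->
  \sum_v extension_weight e D s v <= (size s).+2%:R.
Proof.
move=> D0 hD; rewrite /extension_weight !big_split /=.
have -> : (size s).+2%:R = 1 + 1 + (size s)%:R :> R by rewrite -!natr1; lra.
apply: lerD; first apply: lerD.
- rewrite sumr_const -[X in X <= _]mulr_natr mulrC cardT -cardE.
  have [->|T0] := eqVneq (#|T|%:R : R) 0; first by rewrite mul0r.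
  by rewrite mulfV.
- by rewrite -mulr_suml -natr_sum ler_pdivrMr // mul1r.
rewrite exchange_big /= -sum1_size natr_sum; apply: ler_sum => u _.
rewrite -mulr_suml -natr_sum.
have -> : (\sum_v e u v)%N = degree e u.
  by rewrite /degree -sum1dep_card [RHS]big_mkcond /=; apply: eq_bigr => v _; case: (e u v).
have [->|T0] := eqVneq ((degree e u)%:R : R) 0; first by rewrite mul0r.
by rewrite mulfV.
Qed.

Lemma sum_weight (R : realType) (T : finType) (e : rel T) (D : R) (k : nat) :
  0 < D -> (\sum_v degree e v)%:R <= D ->
  \sum_(t : k.-tuple T) weight e D t <= (k.+1)`!%:R.
Proof.
move=> D0 hD; elim: k => [|k IH].
  rewrite (big_pred1 [tuple]) ?big_tuple0 //= => t.
  by apply/esym/eqP; exact: tuple0.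
rewrite (reindex (fun p : T * k.-tuple T => [tuple of p.1 :: p.2])) /=; last first.
  exists (fun t => (thead t, [tuple of behead t])) => [[v t] _|t _] /=.
    by rewrite theadE; congr (_, _); apply: val_inj.
  by rewrite -tuple_eta.
rewrite -(pair_bigA _ (fun v (t : k.-tuple T) =>
  extension_weight e D t v * weight e D t)) /= exchange_big /=.
apply: (@le_trans _ _ (\sum_(t : k.-tuple T) (k.+2)%:R * weight e D t)).
  apply: ler_sum => t _; rewrite -mulr_suml ler_wpM2r ?weight_ge0 ?(ltW D0) //.
  by apply: (le_trans (sum_extension_weight t D0 hD)); rewrite size_tuple.
by rewrite -mulr_sumr factS natrM ler_wpM2l.
Qed.

(** [w] is a lower bound for the weight of some enumeration of [S]. *)
Definition attains (R : realType) (T : finType) (e : rel T) (D : R)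
    (S : {set T}) (w : R) : Prop :=
  exists s : seq T, [/\ uniq s, s =i S & w <= weight e D s].

(** Distinct sets have distinct enumerations, and the total weight of all
    enumerations is bounded by [sum_weight]. *)
Lemma card_attaining (R : realType) (T : finType) (e : rel T) (D w : R) (k : nat)
    (F : {set {set T}}) :
  0 < D -> (\sum_v degree e v)%:R <= D ->
  (forall S, S \in F -> #|S| = k /\ attains e D S w) ->
  #|F|%:R * w <= (k.+1)`!%:R.
Proof.
move=> D0 hD hF; apply: le_trans (sum_weight (e := e) k D0 hD).
have enum S : S \in F -> exists t : k.-tuple T,
    [set x in t]%SET = S /\ w <= weight e D t.
  move=> /hF [cS [s [us sS ws]]].
  have sz : size s == k by rewrite -cS -(eq_card sS); apply/eqP/esym/card_uniqP.
  exists (Tuple sz); split => //.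
  by apply/setP => x; rewrite inE -sS.
have [->|[S0 /enum [t0 _]]] := set_0Vmem F.
  by rewrite cards0 mul0r; apply: sumr_ge0 => t _; rewrite weight_ge0 // (ltW D0).
have /choice[g hg] : forall S : {set T}, exists t : k.-tuple T,
    S \in F -> [set x in t]%SET = S /\ w <= weight e D t.
  move=> S; case: (boolP (S \in F)) => [/enum [t ht]|_]; first by exists t.
  by exists t0.
have ginj : {in F &, injective g}.
  by move=> S S' SF SF' gE; rewrite -(hg S SF).1 -(hg S' SF').1 gE.
rewrite mulrC mulr_natr -sumr_const.
apply: (@le_trans _ _ (\sum_(S in F) weight e D (g S))).
  by apply: ler_sum => S /hg [].
rewrite -(big_imset (fun t : k.-tuple T => weight e D t) ginj) /=.
rewrite [X in _ <= X](bigID (mem (g @: F))) /= lerDl.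
by apply: sumr_ge0 => t _; rewrite weight_ge0 // (ltW D0).
Qed.

Lemma attains0 (R : realType) (T : finType) (e : rel T) (D : R) :
  attains e D finset.set0 1.
Proof.
exists [::]; split; [by []| |exact: lexx].
by move=> x; rewrite finset.in_set0 in_nil.
Qed.

Lemma attains_le (R : realType) (T : finType) (e : rel T) (D : R) S w w' :
  w' <= w -> attains e D S w -> attains e D S w'.
Proof. by move=> le [s [us sS ws]]; exists s; split => //; apply: le_trans ws. Qed.

Lemma attainsU1 (R : realType) (T : finType) (e : rel T) (D : R) S w (c : R) v :
  0 < D -> 0 <= w -> attains e D S w -> v \notin S ->
  (forall s, s =i S -> c <= extension_weight e D s v) ->
  attains e D (v |: S)%SET (w * c).
Proof.
move=> D0 w0 [s [us sS ws]] vS hc; exists (v :: s); split.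
- by rewrite /= us sS vS.
- by move=> x; rewrite !inE sS.
rewrite /= mulrC; apply: (@le_trans _ _ (extension_weight e D s v * w)).
  by rewrite ler_wpM2r // hc.
by rewrite ler_wpM2l // extension_weight_ge0 // (ltW D0).
Qed.

Lemma attains_free (R : realType) (T : finType) (e : rel T) (D : R) S w v :
  0 < D -> 0 <= w -> attains e D S w -> v \notin S ->
  attains e D (v |: S)%SET (w * #|T|%:R^-1).
Proof.
move=> D0 w0 aS vS; apply: attainsU1 => // s _.
rewrite /extension_weight -addrA lerDl addr_ge0 ?divr_ge0 ?(ltW D0) //.
by apply: sumr_ge0 => u _; rewrite divr_ge0.
Qed.

Lemma attains_degree (R : realType) (T : finType) (e : rel T) (D : R) S w v :
  0 < D -> 0 <= w -> attains e D S w -> v \notin S ->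
  attains e D (v |: S)%SET (w * ((degree e v)%:R / D)).
Proof.
move=> D0 w0 aS vS; apply: attainsU1 => // s _.
rewrite /extension_weight addrAC lerDr addr_ge0 ?invr_ge0 //.
by apply: sumr_ge0 => u _; rewrite divr_ge0.
Qed.

Lemma attains_neighbour (R : realType) (T : finType) (e : rel T) (D : R) S w u v :
  0 < D -> 0 <= w -> attains e D S w -> v \notin S -> u \in S -> e u v ->
  attains e D (v |: S)%SET (w * (degree e u)%:R^-1).
Proof.
move=> D0 w0 aS vS uS euv; apply: attainsU1 => // s sS.
rewrite /extension_weight; have us : u \in s by rewrite sS.
rewrite (perm_big _ (perm_to_rem us)) big_cons /= euv mul1r.
rewrite addrCA lerDl !addr_ge0 ?invr_ge0 ?divr_ge0 ?(ltW D0) //.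
by apply: sumr_ge0 => x _; rewrite divr_ge0.
Qed.

(** Adds the vertices of [A] one at a time; the factor gained by a vertex has
    to be available whatever superset of [S] is already listed. *)
Lemma attainsU (R : realType) (T : finType) (e : rel T) (D : R)
    (S A : {set T}) (w : R) (c : T -> R) :
  0 <= w -> attains e D S w -> {in A, forall v, v \notin S} ->
  (forall v, v \in A -> 0 <= c v) ->
  (forall v (S' : {set T}) (w' : R), v \in A -> S \subset S' -> v \notin S' -> 0 <= w' ->
     attains e D S' w' -> attains e D (v |: S')%SET (w' * c v)) ->
  attains e D (S :|: A)%SET (w * \prod_(v in A) c v).
Proof.
move=> w0 aS SA c0 step.
suff [_ //] : 0 <= w * \prod_(v in A) c v /\
  attains e D (S :|: A)%SET (w * \prod_(v in A) c v).
have: A \subset A by [].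
move: {1 3 4 5}A => B; move: {-1}#|B| (erefl #|B|) => n.

elim: n B => [|n IH] B.
  by move/cards0_eq -> => _; rewrite finset.setU0 big_set0 mulr1; split.
have [->|[x xB]] := set_0Vmem B; first by rewrite cards0.
rewrite -(finset.setD1K xB) cardsU1 !inE eqxx /= add1n => -[/IH {}IH].
rewrite finset.subUset finset.sub1set => /andP[xA /IH [wB aB]].
rewrite big_setU1 ?inE ?eqxx //= mulrCA [c x * _]mulrC.
split; first by rewrite mulr_ge0 // c0.
rewrite finset.setUCA; apply: step => //; first exact: finset.subsetUl.
by rewrite !inE eqxx orbF; exact: SA.
Qed.

(** * Every set has a heavy enumeration *)

Lemma degree_gt0 (T : finType) (e : rel T) (u v : T) : e u v -> (0 < degree e u)%N.
Proof. by move=> euv; apply/card_gt0P; exists v; rewrite inE. Qed.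

(** If each vertex of [L] has a neighbour in [L], the vertices of [L] can be
    listed with factors of at least [1 / q] on average: a vertex with a listed neighbour [u]
    gets [1 / deg u], which is at least [1 / q], and an edge [u v] with no
    listed end gets [deg u / q ^ 2] for [u] and then [1 / deg u] for [v]. *)
Lemma attains_grow (R : realType) (T : finType) (e : rel T) (q w : R)
    (S L : {set T}) :
  symmetric e -> irreflexive e -> 0 < q -> 0 <= w -> attains e (q ^+ 2) S w ->
  {in L, forall v, v \notin S} ->
  {in L, forall v, exists2 u, u \in L & e v u} ->
  {in L, forall v, (degree e v)%:R <= q} ->
  attains e (q ^+ 2) (S :|: L)%SET (w * q^-1 ^+ #|L|).
Proof.
move=> esym eirr q0 w0 aS SL nbr degL.
have D0 : 0 < q ^+ 2 by rewrite exprn_gt0.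
have iq (n : nat) : 0 <= q^-1 ^+ n by rewrite exprn_ge0 // invr_ge0 ltW.
suff grow (n : nat) (P : {set T}) : P \subset L -> (#|L :\: P| <= n)%N ->
    attains e (q ^+ 2) (S :|: P)%SET (w * q^-1 ^+ #|P|) ->
    attains e (q ^+ 2) (S :|: L)%SET (w * q^-1 ^+ #|L|).
  apply: (grow _ finset.set0 _ (leqnn _)); first exact: finset.sub0set.
  by rewrite finset.setU0 cards0 expr0 mulr1.
(* [P] is the listed part of [L]; each step lists one or two more vertices. *)
elim: n P => [|n IH] P PL.
  rewrite leqn0 cards_eq0 finset.setD_eq0 => LP.
  by have -> : P = L by apply/eqP; rewrite finset.eqEsubset PL.
have [LP _|[v]] := set_0Vmem (L :\: P).
  have -> // : P = L by apply/eqP; rewrite finset.eqEsubset PL -finset.setD_eq0 LP /=.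
rewrite inE => /andP[vP vL] cLP aP.
have step (P' : {set T}) x : x \in L -> x \notin P' -> P \subset P' ->
    (#|L :\: (x |: P')| <= n)%N.
  move=> xL xP' PP'; rewrite -ltnS; apply: leq_trans cLP.
  apply: proper_card; apply/properP; split.
    apply: finset.setDS; apply: fintype.subset_trans PP' _; exact: finset.subsetUr.
  exists x; rewrite !inE ?eqxx // xL andbT.
  by apply: contra xP'; apply/fintype.subsetP.
have [u uL evu] := nbr v vL.
have notS x (P' : {set T}) : x \in L -> x \notin P' -> x \notin (S :|: P')%SET.
  by move=> xL xP; rewrite inE negb_or xP SL.
have degq x y : x \in L -> e x y -> q^-1 <= (degree e x)%:R^-1.
  by move=> xL exy; rewrite lef_pV2 ?posrE ?ltr0n ?(degree_gt0 exy) // degL.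
case: (boolP (u \in P)) => uP.
  apply: (IH (v |: P)%SET); first by rewrite finset.subUset finset.sub1set vL.
    exact: step.
  rewrite cardsU1 vP add1n finset.setUCA.
  have euv : e u v by rewrite esym.
  apply: attains_le (attains_neighbour D0 _ aP (notS _ _ vL vP) _ euv).
  - by rewrite exprSr mulrA ler_wpM2l ?mulr_ge0 // (degq _ v).
  - by rewrite mulr_ge0.
  - by rewrite inE uP orbT.
have vu : v != u by apply: contraL evu => /eqP ->; rewrite eirr.
have vuP : v \notin (u |: P)%SET by rewrite !inE negb_or vu.
apply: (IH (v |: (u |: P))%SET).
- by rewrite !finset.subUset !finset.sub1set vL uL.
- by apply: step => //; exact: finset.subsetUr.
have a1 := attains_degree D0 (mulr_ge0 w0 (iq _)) aP (notS _ _ uL uP).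
have euv : e u v by rewrite esym.
have w1 : 0 <= w * q^-1 ^+ #|P| * ((degree e u)%:R / q ^+ 2).
  by apply: mulr_ge0; [exact: mulr_ge0|rewrite divr_ge0 // ltW].
have vS1 : v \notin (u |: (S :|: P))%SET.
  by rewrite -finset.setUCA notS.
have uS1 : u \in (u |: (S :|: P))%SET by rewrite !inE eqxx.
have a2 := attains_neighbour D0 w1 a1 vS1 uS1 euv.
rewrite cardsU1 vuP cardsU1 uP finset.setUCA (finset.setUCA S).
apply: attains_le a2; rewrite !add1n !exprS.
have d0 : (degree e u)%:R != 0 :> R by rewrite pnatr_eq0 -lt0n (degree_gt0 euv).
have q0' : q != 0 by rewrite lt0r_neq0.
rewrite le_eqVlt; apply/orP; left; apply/eqP.
set X := q^-1 ^+ #|P|; field.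
by rewrite d0.
Qed.

(** The factors of the vertices of degree at least [q] and of the low vertices
    without low neighbours in [S] deviate from [1 / q].  For a level [t], let
    [A] be the set of low vertices whose factor is at most [1 / (t q)], and [B]
    the set of vertices of degree at least [t q].  The neighbours in [S] of a
    vertex of [A] lie in [B], so that the hypothesis is the one that
    [prod_le_of_tails] needs. *)
Lemma heavy_enumeration (R : realType) (T : finType) (e : rel T) (q U : R)
    (S : {set T}) :
  symmetric e -> irreflexive e -> 0 < q -> q <= #|T|%:R -> 0 <= U ->
  (forall A B : {set T}, A \subset S -> B \subset S -> {in A, forall v, v \notin B} ->
     {in A & S, forall v u, e v u -> u \in B} -> #|A|%:R <= U + #|B|%:R) ->
  attains e (q ^+ 2) S (q ^+ #|S| * (#|T|%:R / q) `^ U)^-1.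
Proof.
move=> esym eirr q0 qN U0 hAB.
have D0 : 0 < q ^+ 2 by rewrite exprn_gt0.
pose Hi := [set v in S | q <= (degree e v)%:R]%SET.
pose Lo := (S :\: Hi)%SET.
pose I := [set v in Lo | [forall u in Lo, ~~ e v u]]%SET.
pose L := (Lo :\: I)%SET.
have HiS : Hi \subset S by apply/fintype.subsetP => x; rewrite inE => /andP[].
have nI v u : v \in I -> u \in S -> e v u -> u \in Hi.
  rewrite inE => /andP[_ /forallP /(_ u)] + uS euv.
  by rewrite euv implybF /Lo inE uS andbT negbK.
have IS v : v \in I -> v \in S by rewrite !inE => /andP[/andP[]].
have IHi v : v \in I -> v \notin Hi by rewrite !inE => /andP[/andP[]].
have NT : 0 < #|T|%:R :> R by apply: lt_le_trans q0 qN.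
(* [y v] is the least degree of a neighbour of [v] in [S], and the number of
   all vertices if there is none. *)
have /choice[y hy] : forall v, exists y : R, v \in I ->
    [/\ q <= y, y <= #|T|%:R, {in S, forall u, e v u -> y <= (degree e u)%:R} &
     forall (S' : {set T}) (w' : R), Hi \subset S' -> v \notin S' -> 0 <= w' ->
       attains e (q ^+ 2) S' w' -> attains e (q ^+ 2) (v |: S')%SET (w' * y^-1)].
  move=> v; have [no|[u0]] := set_0Vmem [set u in Hi | e v u]%SET.
    exists #|T|%:R => vI; split => // [u uS euv|S' w' HS' vS' w0 aS'].
      have := nI v u vI uS euv; move/setP: no => /(_ u).
      by rewrite finset.in_set0 inE euv andbT => ->.
    exact: attains_free.
  rewrite inE => u0H.
  pose P := fun u => (u \in Hi) && e v u.
  have [u /andP[uH evu] umin] := @arg_minnP T u0 P (degree e) u0H.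
  exists (degree e u)%:R => vI; split.
  - by move: uH; rewrite inE => /andP[].
  - by rewrite ler_nat max_card.
  - move=> u' u'S evu'; rewrite ler_nat umin // /P evu' andbT.
    exact: nI vI u'S evu'.
  - move=> S' w' HS' vS' w0 aS'; apply: attains_neighbour => //.
      exact: (fintype.subsetP HS').
    by rewrite esym.
have a1 : attains e (q ^+ 2) Hi (\prod_(v in Hi) ((degree e v)%:R / q ^+ 2)).
  rewrite -[Hi in attains _ _ Hi]finset.set0U -[X in attains _ _ _ X]mul1r.
  apply: attainsU => //.
  - exact: attains0.
  - by move=> v _; rewrite finset.in_set0.
  - by move=> v _; rewrite divr_ge0 // ltW.
  - by move=> v S' w' vH _ vS' w0' aS'; apply: attains_degree.
have w1 : 0 <= \prod_(v in Hi) ((degree e v)%:R / q ^+ 2).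
  by apply: prodr_ge0 => v _; rewrite divr_ge0 // ltW.
have a2 : attains e (q ^+ 2) (Hi :|: L)%SET
    (\prod_(v in Hi) ((degree e v)%:R / q ^+ 2) * q^-1 ^+ #|L|).
  apply: attains_grow => //.
  - by move=> v; rewrite !inE => /andP[_ /andP[]].
  - move=> v /finset.setDP[vL]; rewrite inE vL /= negb_forall => /existsP[u].
    rewrite negb_imply negbK => /andP[uL evu]; exists u => //.
    rewrite inE uL andbT inE uL /= negb_forall; apply/existsP; exists v.
    by rewrite negb_imply vL negbK esym.
  - move=> v /finset.setDP[]; rewrite inE => /andP[+ vS] _.
    by rewrite inE vS /= -ltNge => /ltW.
have a3 : attains e (q ^+ 2) ((Hi :|: L) :|: I)%SET
    (\prod_(v in Hi) ((degree e v)%:R / q ^+ 2) * q^-1 ^+ #|L|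
     * \prod_(v in I) (y v)^-1).
  apply: attainsU => //.
  - by rewrite mulr_ge0 // exprn_ge0 // invr_ge0 ltW.
  - by move=> v vI; rewrite inE negb_or IHi // inE vI.
  - by move=> v /hy[? _ _ _]; rewrite invr_ge0; lra.
  - move=> v S' w' /hy[_ _ _ st] HS' vS' w0 aS'; apply: st => //.
    by apply: fintype.subset_trans HS'; exact: finset.subsetUl.
have SE : ((Hi :|: L) :|: I)%SET = S.
  apply/setP => v; apply/idP/idP.
    rewrite !inE => /orP[/orP[/andP[]//|/andP[_ /andP[]//]]|/andP[/andP[]//]].
  move=> vS; rewrite inE [v \in (_ :|: L)]inE [v \in L]inE /Lo [v \in (_ :\: _)%SET]inE.
  by rewrite vS andbT; case: (v \in Hi); case: (v \in I).
rewrite SE in a3; apply: attains_le a3.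
have cS : #|S| = (#|Hi| + #|L| + #|I|)%N.
  rewrite -SE !cardsU.
  have -> : ((Hi :|: L) :&: I = finset.set0)%SET.
    apply/setP => v; rewrite finset.in_set0 inE; apply/negbTE; apply/andP => -[+ vI].
    by rewrite inE (negbTE (IHi _ vI)) inE vI.
  have -> : (Hi :&: L = finset.set0)%SET.
    apply/setP => v; rewrite finset.in_set0 inE; apply/negbTE; apply/andP => -[vH].
    by rewrite inE /Lo [v \in (_ :\: _)%SET]inE vH andbF.
  by rewrite !cards0 !subn0.
pose Q : R := #|T|%:R / q.
have Q1 : 1 <= Q by rewrite ler_pdivlMr // mul1r.
have main : \prod_(v in I) (y v / q) <= Q `^ U * \prod_(v in Hi) ((degree e v)%:R / q).
  have toseq (A : {set T}) (g : T -> R) :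
      \prod_(v in A) g v = \prod_(x <- sort <=%R [seq g v | v <- enum A]) x.
    rewrite (perm_big _ (permEl (perm_sort _ _))) big_map -big_enum.
    by [].
  rewrite !toseq; apply: prod_le_of_tails => //.
  - by apply: sort_sorted; exact: le_total.
  - by apply: sort_sorted; exact: le_total.
  - rewrite all_sort; apply/allP => _ /mapP[v + ->]; rewrite mem_enum => /hy[qy yN _ _].
    by rewrite ler_pdivlMr // mul1r qy ler_pdivrMr // /Q divfK // lt0r_neq0.
  - rewrite all_sort; apply/allP => _ /mapP[v + ->]; rewrite mem_enum inE => /andP[_ qd].
    by rewrite ler_pdivlMr // mul1r.
  move=> t _; rewrite !count_sort !count_map.
  have cnt (A : {set T}) (a : pred T) : count a (enum A) = #|[set v in A | a v]%SET|.
    rewrite -size_filter cardE /enum_mem -filter_predI; congr size.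
    by apply: eq_filter => v; rewrite /= inE andbC.
  rewrite !cnt; apply: hAB.
  - by apply/fintype.subsetP => v; rewrite inE => /andP[/IS].
  - by apply/fintype.subsetP => v; rewrite inE => /andP[/(fintype.subsetP HiS)].
  - by move=> v; rewrite inE => /andP[/IHi vH _]; rewrite inE (negbTE vH).
  - move=> v u; rewrite inE => /andP[vI tv] uS evu; rewrite inE (nI v u) //=.
    apply: le_trans tv _; rewrite ler_pM2r ?invr_gt0 //.
    by have [_ _ h _] := hy v vI; apply: h.
have QU : 0 < Q `^ U by rewrite powR_gt0 // (lt_le_trans _ Q1).
have PI : 0 < \prod_(v in I) (y v / q).
  by apply: prodr_gt0 => v /hy[? _ _ _]; rewrite divr_gt0 //; lra.
have -> : \prod_(v in Hi) ((degree e v)%:R / q ^+ 2) =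
    \prod_(v in Hi) ((degree e v)%:R / q) * q^-1 ^+ #|Hi|.
  rewrite -prodr_const -big_split; apply: eq_bigr => v _ /=.
  by rewrite expr2 invfM mulrA.
have -> : \prod_(v in I) (y v)^-1 = (\prod_(v in I) (y v / q))^-1 * q^-1 ^+ #|I|.
  rewrite -prodfV -prodr_const -big_split; apply: eq_bigr => v vI /=.
  have [? _ _ _] := hy v vI.
  by rewrite invf_div mulrAC mulfV ?mul1r // lt0r_neq0.
rewrite cS !exprD -/Q.
set h := \prod_(v in Hi) _ in main *; set i := \prod_(v in I) _ in main PI *.
have qp n : 0 < q ^+ n by rewrite exprn_gt0.
have -> : h * q^-1 ^+ #|Hi| * q^-1 ^+ #|L| * (i^-1 * q^-1 ^+ #|I|) =
   (q ^+ #|Hi| * q ^+ #|L| * q ^+ #|I|)^-1 * (h / i).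
  rewrite !exprVn; field.
  by rewrite !lt0r_neq0.
rewrite invfM ler_pM2l ?invr_gt0 ?mulr_gt0 //.
by rewrite ler_pdivlMr // mulrC ler_pdivrMr // mulrC.
Qed.

(** * Counting dense sets *)

Definition pairs_in (n : nat) (S : {set 'I_n}) : {set vpair n} :=
  [set e : vpair n | ((val e).1 \in S) && ((val e).2 \in S)]%SET.

(** The ordered pairs underlying [X], each pair in both directions. *)
Definition darts (n : nat) (X : {set vpair n}) : {set 'I_n * 'I_n} :=
  [set p | [exists e in X, (val e == p) || (val e == (p.2, p.1))]]%SET.

Definition adjacent (n : nat) (X : {set vpair n}) : rel 'I_n :=
  fun u v => (u, v) \in darts X.

Lemma adjacent_sym n (X : {set vpair n}) : symmetric (adjacent X).
Proof.
by move=> u v; rewrite /adjacent !inE; apply: eq_existsb => e; rewrite orbC.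
Qed.

Lemma adjacent_irr n (X : {set vpair n}) : irreflexive (adjacent X).
Proof.
move=> u; rewrite /adjacent inE; apply/negbTE; apply/existsP => -[e].
by move: (valP e) => /[swap] /andP[_ /orP[] /eqP ->]; rewrite ltnn.
Qed.

Lemma card_darts n (X : {set vpair n}) : #|darts X| = (2 * #|X|)%N.
Proof.
pose rev (e : vpair n) := ((val e).2, (val e).1).
have revI : injective rev.
  move=> e e' [h2 h1]; apply: val_inj.
  by rewrite (surjective_pairing (val e)) (surjective_pairing (val e')) h1 h2.
have -> : darts X = ((val @: X) :|: (rev @: X))%SET.
  apply/setP => -[u v]; rewrite !inE; apply/existsP/orP.
    case=> e /andP[eX /orP[] /eqP h]; [left|right]; apply/imsetP; exists e => //.
    by rewrite /rev h.
  case=> /imsetP[e eX h]; exists e; rewrite eX /=; first by rewrite h eqxx.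
  by case: h => -> ->; rewrite -surjective_pairing eqxx orbT.
rewrite cardsU (card_imset _ val_inj) (card_imset _ revI).
have -> : ((val @: X) :&: (rev @: X) = finset.set0)%SET.
  apply/setP => p; rewrite finset.in_set0 inE; apply/negbTE; apply/andP.
  case=> /imsetP[e _ ->] /imsetP[e' _ h].
  move: (valP e) (valP e'); rewrite h /= => /ltn_trans /[apply].
  by rewrite ltnn.
by rewrite cards0 subn0 mul2n addnn.
Qed.

Lemma sum_degree_adjacent n (X : {set vpair n}) :
  (\sum_v degree (adjacent X) v = 2 * #|X|)%N.
Proof.
rewrite -card_darts -sum1_card.
under eq_bigr do rewrite /degree -sum1_card.
rewrite pair_big_dep /=; apply: eq_bigl => -[u v] /=.
by rewrite inE.
Qed.

Lemma darts_pairs_in n (S : {set 'I_n}) :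
  darts (pairs_in S) = (finset.setX S S :\: [set (u, u) | u in 'I_n])%SET.
Proof.
apply/setP => -[u v]; rewrite !inE /=; apply/existsP/andP.
  case=> e; rewrite inE => /andP[/andP[e1 e2] h]; split.
    apply/imsetP => -[w _ [uw vw]]; move: h; rewrite uw vw orbb.
    case: e {e1 e2} => -[a b] /= ab /eqP[aw bw].
    by move: ab; rewrite /= aw bw ltnn.
  case: e h e1 e2 => -[a b] /= ab; rewrite !xpair_eqE.
  by case/orP => /andP[/eqP -> /eqP ->] -> ->.
case=> uv /andP[uS vS].
have [lt|lt|/val_inj eq] := ltngtP u v.
- exists (exist _ (u, v) lt : vpair n); by rewrite inE /= uS vS eqxx.
- exists (exist _ (v, u) lt : vpair n); by rewrite inE /= uS vS eqxx orbT.
by case/imsetP: uv; exists u; rewrite ?eq.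
Qed.

Lemma card_pairs_in n (S : {set 'I_n}) :
  (2 * #|pairs_in S| + #|S| = #|S| ^ 2)%N.
Proof.
rewrite -card_darts darts_pairs_in -mulnn -cardsX addnC.
rewrite -(cardsID [set (u, u) | u in 'I_n] (finset.setX S S)); congr addn.
have -> : (finset.setX S S :&: [set (u, u) | u in 'I_n] = [set (u, u) | u in S])%SET.
  apply/setP => -[u v]; rewrite !inE /=; apply/andP/imsetP.
    by case=> /andP[uS _] /imsetP[w _ [uw vw]]; exists u; rewrite // uw vw.
  by case=> w wS [-> ->]; rewrite wS; split => //; apply/imsetP; exists w.
by rewrite card_imset // => u v [].
Qed.

(** The pairs in [A * (S \ B)] and in [(S \ B) * A] are not darts; as [A] is
    contained in [S \ B], these two sets meet exactly in [A * A]. *)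
Lemma card_isolated_part n (X : {set vpair n}) (S A B : {set 'I_n}) :
  A \subset S -> B \subset S -> {in A, forall v, v \notin B} ->
  {in A & S, forall v u, adjacent X v u -> u \in B} ->
  (2 * #|X :&: pairs_in S| + 2 * #|A| * (#|S| - #|B|) <= #|S| ^ 2 + #|A| ^ 2)%N.
Proof.
move=> AS BS AB nb.
pose C := (S :\: B)%SET.
have AC : A \subset C by apply/fintype.subsetP => v vA; rewrite inE AB // (fintype.subsetP AS).
have cC : #|C| = (#|S| - #|B|)%N by rewrite cardsD (finset.setIidPr BS).
rewrite -cC -card_darts -[(#|S| ^ 2)%N]mulnn -[(#|A| ^ 2)%N]mulnn -!cardsX.
have nbC v u : v \in A -> u \in C -> ~~ adjacent X v u.
  move=> vA; rewrite inE => /andP[uB uS]; apply: contra uB; exact: nb.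
have sub : darts (X :&: pairs_in S) \subset
    (finset.setX S S :\: (finset.setX A C :|: finset.setX C A))%SET.
  apply/fintype.subsetP => -[u v] uv.
  have uvX : adjacent X u v.
    move: uv; rewrite /adjacent !inE => /existsP[e /andP[+ h]].
    by rewrite inE => /andP[eX _]; apply/existsP; exists e; rewrite eX.
  have : (u, v) \in darts (pairs_in S).
    move: uv; rewrite !inE => /existsP[e /andP[+ h]].
    by rewrite inE => /andP[_ eX]; apply/existsP; exists e; rewrite eX.
  rewrite darts_pairs_in finset.in_setD finset.in_setX /= => /andP[_ /andP[uS vS]].
  rewrite finset.in_setD finset.in_setU !finset.in_setX /= uS vS andbT negb_or.
  rewrite andbT; apply/andP; split; apply/negP => /andP[h1 h2].
    by move: (nbC _ _ h1 h2); rewrite uvX.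
  by move: (nbC _ _ h2 h1); rewrite adjacent_sym uvX.
have CS x : x \in C -> x \in S by rewrite inE => /andP[].
have sub' : (finset.setX A C :|: finset.setX C A)%SET \subset finset.setX S S.
  apply/fintype.subsetP => -[u v]; rewrite finset.in_setU !finset.in_setX /=.
  have AS' := fintype.subsetP AS.
  by case/orP=> /andP[h1 h2]; rewrite ?(CS _ h1) ?(CS _ h2) ?(AS' _ h1) ?(AS' _ h2).
have EAA : (finset.setX A C :&: finset.setX C A = finset.setX A A)%SET.
  apply/setP => -[u v]; rewrite finset.in_setI !finset.in_setX /=.
  have := fintype.subsetP AC u; have := fintype.subsetP AC v.
  by case: (u \in A); case: (v \in A); case: (u \in C); case: (v \in C) => //= h1 h2;
    rewrite ?h1 ?h2.
have lA := subset_leq_card AC.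
have lC : (#|C| <= #|S|)%N by rewrite cC leq_subr.
have := subset_leq_card sub; have := subset_leq_card sub'.
rewrite cardsD (finset.setIidPr sub') cardsU EAA.
rewrite !cardsX; nia.
Qed.

(** The density condition and [card_isolated_part] put [|A| / k] and
    [|B| / k] under the constraint of [surplus_optimal], with [eta = 1 / k]
    since [k ^ 2] exceeds twice the number of pairs by [k]. *)
Lemma card_dense_sets (R : realType) n (X : {set vpair n}) (q beta : R) (k : nat) :
  (0 < k)%N -> 0 <= beta <= 1 -> 0 < q -> q <= n%:R ->
  2 * #|X|%:R <= q ^+ 2 ->
  #|[set S : {set 'I_n} | (#|S| == k) &&
      (beta * #|pairs_in S|%:R <= #|X :&: pairs_in S|%:R)]%SET|%:R
  <= (k.+1)`!%:R *
     (q ^+ k * (n%:R / q) `^ (k%:R * (surplus beta + 2 * Num.sqrt k%:R^-1))).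
Proof.
move=> k0 b01 q0 qn hX; have /andP[b0 b1] := b01.
set U := k%:R * _.
have kR : 0 < k%:R :> R by rewrite ltr0n.
have U0 : 0 <= U.
  by rewrite mulr_ge0 // addr_ge0 ?surplus_ge0 // mulr_ge0 // sqrtr_ge0.
have W0 : 0 < q ^+ k * (n%:R / q) `^ U.
  by rewrite mulr_gt0 ?exprn_gt0 // powR_gt0 // divr_gt0 // (lt_le_trans q0).
rewrite -ler_pdivrMr //; apply: (card_attaining (e := adjacent X) (D := q ^+ 2)).
- by rewrite exprn_gt0.
- by rewrite sum_degree_adjacent natrM.
move=> S; rewrite inE => /andP[/eqP cS hS]; split => //.
have := @heavy_enumeration R _ (adjacent X) q U S; rewrite card_ord cS; apply => //.
- exact: adjacent_sym.
- exact: adjacent_irr.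
move=> A B AS BS AB nb.
have := card_isolated_part AS BS AB nb; rewrite cS.
have cB : (#|B| <= k)%N by rewrite -cS subset_leq_card.
have cAB : (#|A| + #|B| <= k)%N.
  rewrite -cS -cardsUI.
  have -> : (A :&: B = finset.set0)%SET.
    apply/setP => v; rewrite finset.in_set0 inE; apply/negbTE; apply/andP => -[vA].
    exact/negP/AB.
  by rewrite cards0 addn0 subset_leq_card // finset.subUset AS.
rewrite -(ler_nat R) !(natrD, natrM, natrX) natrB // => hle.
have := card_pairs_in S; rewrite cS => /(congr1 (fun m : nat => m%:R : R)).
rewrite !(natrD, natrM, natrX) => hk.
move: cAB; rewrite -(ler_nat R) natrD => hab.
set a : R := #|A|%:R in hle hab *; set b : R := #|B|%:R in hle hab *.
set K : R := k%:R in kR hab hk hle U U0 W0 *.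
have Kn0 : K != 0 by rewrite lt0r_neq0.
have Ki : 0 <= K^-1 by rewrite invr_ge0 ltW.
suff : a / K - b / K <= surplus beta + 2 * Num.sqrt K^-1.
  by rewrite -mulrBl ler_pdivrMr // [_ * K]mulrC lerBlDr.
apply: surplus_optimal => //; [by rewrite mulr_ge0|by rewrite mulr_ge0| |].
  by rewrite -mulrDl ler_pdivrMr // mul1r.
rewrite -subr_ge0 -(pmulr_lge0 _ (_ : 0 < K ^+ 2)) ?exprn_gt0 //.
have -> : (1 - beta + K^-1 - (2 * (a / K) - (a / K) ^+ 2 - 2 * (a / K) * (b / K)))
   * K ^+ 2 = (1 - beta) * K ^+ 2 + K - (2 * a * K - a ^+ 2 - 2 * a * b).
  by field.
nra.
Qed.

(** * Success probability of an algorithm *)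

Definition probed (n : nat) (A : algorithm n) (G : graph n) (j : nat) :
  {set vpair n} := (\bigcup_(i < j) select A (transcript A G i))%SET.

Lemma probedS n (A : algorithm n) G j :
  probed A G j.+1 = (probed A G j :|: select A (transcript A G j))%SET.
Proof. by rewrite /probed big_ord_recr. Qed.

Lemma probed_mono n (A : algorithm n) G j l :
  (j <= l)%N -> probed A G j \subset probed A G l.
Proof.
elim: l => [|l IH]; first by rewrite leqn0 => /eqP ->.
rewrite leq_eqVlt => /orP[/eqP -> //|]; rewrite ltnS => /IH jl.
by rewrite probedS; apply: fintype.subset_trans jl (finset.subsetUl _ _).
Qed.

Lemma card_probed n (A : algorithm n) G l :
  (#|probed A G l| <= num_probes A l G)%N.
Proof.
rewrite /num_probes; elim: l => [|l IH].
  by rewrite /probed !big_ord0 cards0.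
by rewrite probedS big_ord_recr /= (leq_trans (leq_card_setU _ _)) // leq_add2r.
Qed.

Lemma transcript_agree n (A : algorithm n) (G G' : graph n) j :
  {in probed A G j, G =1 G'} -> transcript A G j = transcript A G' j.
Proof.
elim: j => [//|j IH] h /=.
have <- : transcript A G j = transcript A G' j.
  by apply: IH => e eP; apply: h; rewrite probedS inE eP.
congr rcons; apply/ffunP => e; rewrite !ffunE; case: ifP => // eS.
by rewrite h // probedS inE eS orbT.
Qed.

Lemma transcript_prefix n (A : algorithm n) (G G' : graph n) i j :
  (i <= j)%N -> transcript A G j = transcript A G' j ->
  transcript A G i = transcript A G' i.
Proof.
elim: j => [|j IH]; first by rewrite leqn0 => /eqP ->.
rewrite leq_eqVlt => /orP[/eqP -> //|]; rewrite ltnS => ij /= /rcons_inj[h _].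
exact: IH.
Qed.

(** The bound on [i] is [j.+1] because the pairs probed in a round are chosen
    before its answers are seen. *)
Lemma eq_probed n (A : algorithm n) (G G' : graph n) i j :
  (i <= j.+1)%N -> transcript A G j = transcript A G' j ->
  probed A G i = probed A G' i.
Proof.
move=> ij h; apply: eq_bigr => m _; congr select.
by apply: transcript_prefix h; rewrite -ltnS (leq_trans (ltn_ord m)).
Qed.

(** Removing an unprobed pair of the result from the graph does not change
    what the algorithm sees, hence not the result, which would then no longer
    be a clique. *)
Lemma result_probed n (A : algorithm n) l :
  (forall G, is_clique G (result A l G)) ->
  forall G, pairs_in (result A l G) \subset probed A G l.
Proof.
move=> clq G; apply/fintype.subsetP => e; rewrite inE => /andP[e1 e2].
apply/negPn/negP => eP.
pose G' : graph n := [ffun e' => (e' != e) && G e'].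
have tE : transcript A G l = transcript A G' l.
  apply: transcript_agree => e' e'P; rewrite ffunE.
  by have -> : e' != e by apply: contraTneq e'P => ->.
have := clq G' e; rewrite /result -tE ffunE eqxx /=.
by move=> /(_ e1 e2).
Qed.

Definition fresh n (A : algorithm n) l i (S : {set 'I_n}) (G : graph n) :=
  ((probed A G l :&: pairs_in S) :\: probed A G i)%SET.

(** Conditionally on the first [i] rounds, at least [mu] further pairs of [S]
    are probed and all of them are edges with probability at most
    [2 ^ (- mu)], although the choice of the pairs is adaptive.  From a graph
    with this property delete an arbitrary set [Z] of its fresh pairs.  Both
    the graph and [Z] can be recovered from the outcome: rerun the algorithm
    on it, answering positively each pair of [S] that was not probed in the
    first [i] rounds.  This rerun sees the answers of the original run, so it
    reveals the fresh pairs, all of which belonged to the graph. *)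
Lemma card_fresh_present (R : realType) n (A : algorithm n) l i (S : {set 'I_n})
    (D : pred (graph n)) (mu : R) :
  (forall G G', transcript A G i = transcript A G' i -> D G = D G') ->
  #|[set G | [&& D G, [forall e in fresh A l i S G, G e]
              & mu <= #|fresh A l i S G|%:R]]%SET|%:R * 2 `^ mu
   <= #|[set G | D G]%SET|%:R :> R.
Proof.
move=> hD; set Ev := [set G | [&& D G, _ & _]]%SET.
pose P := [set p : graph n * {set vpair n} |
             (p.1 \in Ev) && (p.2 \subset fresh A l i S p.1)]%SET.
pose erase (p : graph n * {set vpair n}) : graph n :=
  [ffun e => p.1 e && (e \notin p.2)].
have cP : #|Ev|%:R * 2 `^ mu <= #|P|%:R :> R.
  have -> : #|P| = (\sum_(G in Ev) 2 ^ #|fresh A l i S G|)%N.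
    rewrite -sum1dep_card -(pair_big_dep (mem Ev)
      (fun G (Z : {set vpair n}) => Z \subset fresh A l i S G) (fun _ _ => 1%N)) /=.
    apply: eq_bigr => G _; rewrite -card_powerset -sum1_card.
    by apply: eq_bigl => Z; rewrite inE.
  rewrite natr_sum mulr_natl -sumr_const; apply: ler_sum => G.
  rewrite inE => /and3P[_ _ hmu].
  by rewrite natrX -powR_mulrn // ler_powR // ler1n.
apply: le_trans cP _; rewrite ler_nat.
have tr G (Z : {set vpair n}) : Z \subset fresh A l i S G ->
    transcript A (erase (G, Z)) i = transcript A G i.
  move=> ZF; apply/esym/transcript_agree => e eP; rewrite ffunE /=.
  have -> : e \notin Z; last by rewrite andbT.
  by apply/negP => /(fintype.subsetP ZF); rewrite inE eP.
(* The rerun that recovers [G] and [Z] from [H = erase (G, Z)]. *)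
pose fill (H : graph n) : graph n :=
  [ffun e => H e || (e \in pairs_in S) && (e \notin probed A H i)].
pose F H := ((probed A (fill H) l :&: pairs_in S) :\: probed A H i)%SET.
have recover G (Z : {set vpair n}) : (G, Z) \in P ->
    let H := erase (G, Z) in
    G = [ffun e => H e || (e \in F H)] /\ Z = [set e in F H | ~~ H e]%SET.
  rewrite !inE /= => /andP[/and3P[_ /forallP full _] ZF]; set H := erase (G, Z).
  have full' e : e \in fresh A l i S G -> G e by move=> h; have := full e; rewrite h.
  have HG : probed A H i = probed A G i.
    by apply: (@eq_probed _ _ _ _ _ i) => //; exact: tr.
  have HE e : H e = G e && (e \notin Z) by rewrite ffunE.
  have FE : F H = fresh A l i S G.
    rewrite /F /fresh HG; congr (_ :&: _ :\: _)%SET.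
    apply: (@eq_probed _ _ _ _ _ l) => //; apply/esym/transcript_agree => e eP.
    rewrite ffunE HG HE.
    case: (boolP (e \in Z)) => [/(fintype.subsetP ZF) eF|_] /=.
      rewrite (full' e eF); move: eF.
      by rewrite /fresh finset.in_setD finset.in_setI => /andP[-> /andP[_ ->]].
    rewrite andbT; case: (boolP (G e)) => //= nG.
    apply/esym/negbTE; apply: contra nG => /andP[eS ei].
    by apply: full'; rewrite /fresh inE ei inE eP.
  split.
    apply/ffunP => e; rewrite ffunE FE HE.
    case: (boolP (e \in fresh A l i S G)) => [/full' -> |eF]; first by rewrite orbT.
    rewrite orbF; have -> : e \notin Z; last by rewrite andbT.
    by apply: contra eF; exact: (fintype.subsetP ZF).
  apply/setP => e; rewrite inE FE HE negb_and negbK.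
  case: (boolP (e \in Z)) => [/(fintype.subsetP ZF) -> |eZ]; first by rewrite orbT.
  by case: (boolP (e \in fresh A l i S G)) => //= /full' ->.
have inj : {in P &, injective erase}.
  move=> [G Z] [G1 Z1] /recover[hG hZ] /recover[hG1 hZ1] hE.
  have GE : G = G1 by rewrite hG hE -hG1.
  have ZE : Z = Z1 by rewrite hZ hE -hZ1.
  by rewrite GE ZE.
rewrite -(card_in_imset inj); apply: subset_leq_card.
apply/fintype.subsetP => _ /imsetP[[G Z] + ->].
rewrite !inE /= => /andP[/andP[DG _] ZF].
by rewrite (hD _ G) //; exact: tr.
Qed.

(** All graphs have the same weight, so that probabilities are proportions. *)
Lemma Gnp_prob_half (R : realType) n (P : pred (graph n)) :
  Gnp_prob (2^-1 : R) P = #|[set G | P G]%SET|%:R / #|{: graph n}|%:R.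
Proof.
have half : 1 - 2^-1 = 2^-1 :> R by lra.
rewrite /Gnp_prob /Gnp_weight half.
rewrite (eq_bigr (fun=> (#|{: graph n}|%:R)^-1)); last first.
  move=> G _; rewrite (eq_bigr (fun=> 2^-1)); last by move=> e _; case: ifP.
  by rewrite prodr_const card_ffun card_bool natrX exprVn.
by rewrite sumr_const cardsE mulr_natl.
Qed.

Lemma leq_card_bigcup (I T : finType) (P : pred I) (F : I -> {set T}) :
  (#|(\bigcup_(i | P i) F i)%SET| <= \sum_(i | P i) #|F i|)%N.
Proof.
apply: (big_ind2 (fun (X : {set T}) m => #|X| <= m)%N) => //.
  by rewrite cards0.
by move=> X m Y p Xm Yp; rewrite (leq_trans (leq_card_setU _ _)) // leq_add.
Qed.

(** The union bound over the round [i] in which the proportion of probed pairs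
    of a [k]-subset of the result first reaches [B i.+1], and over the
    [k]-sets that are dense at that time. *)
Lemma prob_large_result (R : realType) n (A : algorithm n) l k
    (B c : nat -> R) (C : nat) :
  (forall G, is_clique G (result A l G)) ->
  (forall S : {set 'I_n}, #|S| = k -> #|pairs_in S| = C) ->
  B 0%N = 0 -> B l = 1 ->
  (forall i G, (i < l)%N ->
     #|[set S : {set 'I_n} | (#|S| == k) &&
        (B i.+1 * C%:R <= #|probed A G i.+1 :&: pairs_in S|%:R)]%SET|%:R <= c i) ->
  Gnp_prob (2^-1 : R) (fun G => (k <= #|result A l G|)%N)
   <= \sum_(i < l) c i / 2 `^ ((1 - B i) * C%:R).
Proof.
move=> clq hC B0 Bl hc.
pose D i (S : {set 'I_n}) : pred (graph n) := fun G =>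
  B i.+1 * C%:R <= #|probed A G i.+1 :&: pairs_in S|%:R.
pose mu i : R := (1 - B i) * C%:R.
pose Ev i S := [set G | [&& D i S G, [forall e in fresh A l i S G, G e]
              & mu i <= #|fresh A l i S G|%:R]]%SET.
have evD i S : #|Ev i S|%:R * 2 `^ (mu i) <= #|[set G | D i S G]%SET|%:R :> R.
  by apply: card_fresh_present => G G' h; rewrite /D (eq_probed _ h).
rewrite Gnp_prob_half ler_pdivrMr; last first.
  rewrite ltr0n; apply/card_gt0P; exists [ffun=> true]; by [].
have cover : [set G | (k <= #|result A l G|)%N]%SET \subset
    (\bigcup_(i < l) \bigcup_(S : {set 'I_n} | #|S| == k) Ev i S)%SET.
  apply/fintype.subsetP => G; rewrite inE => kG.
  have [S SG cS] : exists2 S : {set 'I_n}, S \subset result A l G & #|S| = k.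
    exists [set x in take k (enum (result A l G))]%SET.
      by apply/fintype.subsetP => x; rewrite inE => /mem_take; rewrite mem_enum.
    rewrite cardsE (card_uniqP _) ?take_uniq ?enum_uniq //.
    by rewrite size_takel // -cardE.
  have SC := hC S cS.
  have sub : pairs_in S \subset probed A G l.
    apply: fintype.subset_trans (result_probed clq G).
    apply/fintype.subsetP => e; rewrite !inE => /andP[e1 e2].
    by rewrite !(fintype.subsetP SG).
  pose p i := #|probed A G i :&: pairs_in S|.
  have p0 : p 0%N = 0%N by rewrite /p /probed big_ord0 finset.set0I cards0.
  have pl : p l = C by rewrite /p (finset.setIidPr sub).
  have l0 : (0 < l)%N.
    by case: (posnP l) Bl => // ->; rewrite B0 => /eqP; rewrite eq_sym oner_eq0.
  have ex : exists i, (fun i => B i.+1 * C%:R <= (p i.+1)%:R) i.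
    by exists l.-1; rewrite prednK // Bl pl mul1r.
  (* [i] counts the rounds completed before the share [B i.+1] is reached. *)
  case: (ex_minnP ex) => i hi imin.
  have il : (i < l)%N.
    by rewrite -(prednK l0) ltnS; apply: imin; rewrite prednK // Bl pl mul1r.
  have hpi : (p i)%:R <= B i * C%:R.
    case: i {hi il} imin => [_|i imin]; first by rewrite p0 B0 mul0r.
    by rewrite ltW // ltNge; apply/negP => /imin; rewrite ltnn.
  apply/bigcupP; exists (Ordinal il) => //; apply/bigcupP; exists S; first exact/eqP.
  rewrite inE; apply/and3P; split => //.
    apply/forallP => e; apply/implyP; rewrite !inE => /andP[_ /andP[_ /andP[e1 e2]]].
    by apply: (clq G e); apply: (fintype.subsetP SG).
  have -> : #|fresh A l i S G| = (C - p i)%N.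
    by rewrite /fresh (finset.setIidPr sub) cardsD SC finset.setIC.
  rewrite natrB; last by rewrite -SC subset_leq_card // finset.subsetIr.
  by rewrite /mu mulrBl mul1r lerB.
apply: (@le_trans _ _ (\sum_(i < l) \sum_(S : {set 'I_n} | #|S| == k) #|Ev i S|)%N%:R).
  rewrite ler_nat; apply: leq_trans (subset_leq_card cover) _.
  apply: leq_trans (leq_card_bigcup _ _) _.
  by apply: leq_sum => i _; exact: leq_card_bigcup.
rewrite natr_sum mulr_suml; apply: ler_sum => i _.
have P0 : 0 < 2 `^ (mu i) :> R by rewrite powR_gt0.
rewrite mulrAC ler_pdivlMr //.
apply: (@le_trans _ _ (\sum_(S : {set 'I_n} | #|S| == k) #|[set G | D i S G]%SET|)%N%:R).
  by rewrite !natr_sum mulr_suml; apply: ler_sum => S _; exact: evD.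
under eq_bigr do rewrite -sum1dep_card.
rewrite (exchange_big_dep predT) //= natr_sum -[X in _ <= _ * X]/(#|_|%:R) mulr_natr -sumr_const.
apply: ler_sum => G _; rewrite sum1dep_card; exact: hc.
Qed.

(** * Asymptotic estimates *)

(** Here [x ^ 2] is the number [k] of vertices, [lam = ln 2] and [Lam = ln n].
    The terms of order [x ^ 4] on the left add up to at
    most [- lam t (1 - m / alpha) x ^ 4 / 2], negative as [m < alpha]; all
    others are of order at most [x ^ 3], so that it suffices that [x] is large
    compared with the quotient of the coefficients. *)
Lemma exponent_le (R : realType) (lam Lam alpha m t f x : R) :
  0 < lam -> 0 <= Lam -> 0 < alpha -> 0 <= m -> m < alpha -> 0 < t -> t <= 1 ->
  0 <= f -> 2 * f <= m * t -> 1 <= x ->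
  alpha * Lam <= lam * (x ^+ 2 + 1) ->
  (lam + 8 + lam / 2 + 4 * lam / alpha + 1)
    / (lam * t * (1 - m / alpha) / 2) <= x ->
  2 * (x ^+ 2 + 1) * Num.sqrt (x ^+ 2 + 1) + lam / 2 * x ^+ 2
  + x ^+ 2 * Lam * f + 2 * x * Lam - lam * t * (x ^+ 4 - x ^+ 2) / 2
  <= - x ^+ 2.
Proof.
move=> l0 L0 a0 m0 ma t0 t1 f0 fm x1 aL.
set rho := 1 - m / alpha.
have rho0 : 0 < rho by rewrite subr_gt0 ltr_pdivrMr // mul1r.
set g := lam * t * rho / 2.
have g0 : 0 < g by rewrite divr_gt0 // !mulr_gt0.
have rho1 : rho <= 1 by rewrite gerBl divr_ge0 // ltW.
rewrite ler_pdivrMr // => hx.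
have x0 : 0 < x by lra.
have x2 : 1 <= x ^+ 2 by rewrite exprn_ege1.
have x23 : x ^+ 2 <= x ^+ 3 by rewrite [x ^+ 3]exprS ler_peMl // ltW // exprn_gt0.
set y := Num.sqrt (x ^+ 2 + 1).
have y0 : 0 <= y by apply: sqrtr_ge0.
have y2 : y ^+ 2 = x ^+ 2 + 1 by rewrite sqr_sqrtr // addr_ge0 // sqr_ge0.
have yx : y <= 2 * x.
  rewrite -(@ler_pXn2r _ 2) ?nnegrE //; last by lra.
  by rewrite y2 exprMn; lra.
have LE : Lam <= lam / alpha * (x ^+ 2 + 1).
  by rewrite mulrAC ler_pdivlMr // mulrC.
have h1 : 2 * (x ^+ 2 + 1) * y <= 8 * x ^+ 3.
  apply: (@le_trans _ _ (4 * x ^+ 2 * (2 * x))).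
    by apply: ler_pM => //; lra.
  by rewrite le_eqVlt; apply/orP; left; apply/eqP; ring.
have la0 : 0 < lam / alpha by rewrite divr_gt0.
have L2 : Lam <= lam / alpha * (2 * x ^+ 2).
  by apply: (le_trans LE); rewrite ler_pM2l //; lra.
have h2 : 2 * x * Lam <= 4 * lam / alpha * x ^+ 3.
  apply: (@le_trans _ _ (2 * x * (lam / alpha * (2 * x ^+ 2)))).
    by rewrite ler_pM2l //; lra.
  by rewrite le_eqVlt; apply/orP; left; apply/eqP; field; rewrite lt0r_neq0.
have h3 : x ^+ 2 * Lam * f <= lam * (1 - rho) * t / 2 * (x ^+ 4 + x ^+ 2).
  apply: (@le_trans _ _ (x ^+ 2 * (lam / alpha * (x ^+ 2 + 1)) * (m * t / 2))).
    apply: ler_pM => //; last by lra.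
      by rewrite mulr_ge0 // sqr_ge0.
    by rewrite ler_pM2l // exprn_gt0.
  by rewrite le_eqVlt; apply/orP; left; apply/eqP; rewrite /rho; field; rewrite lt0r_neq0.
have h4 : lam * (1 - rho) * t / 2 * (x ^+ 4 + x ^+ 2) - lam * t * (x ^+ 4 - x ^+ 2) / 2
    <= - g * x ^+ 4 + lam * x ^+ 3.
  have -> : lam * (1 - rho) * t / 2 * (x ^+ 4 + x ^+ 2) - lam * t * (x ^+ 4 - x ^+ 2) / 2
    = - g * x ^+ 4 + lam * (t * ((2 - rho) / 2)) * x ^+ 2 by rewrite /g; field.
  set u := t * _.
  have u0 : 0 <= u by rewrite mulr_ge0 //; lra.
  have u1 : u <= 1 by rewrite mulr_ile1 //; lra.
  clearbody u; rewrite lerD2l -!mulrA ler_pM2l // -[X in _ <= X]mul1r.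
  by apply: ler_pM => //; lra.
have h5 : (lam + 8 + lam / 2 + 4 * lam / alpha + 1) * x ^+ 3 <= g * x ^+ 4.
  have -> : g * x ^+ 4 = (x * g) * x ^+ 3 by ring.
  by rewrite ler_pM2r // exprn_gt0.
have h6 : lam / 2 * x ^+ 2 <= lam / 2 * x ^+ 3 by rewrite ler_pM2l //; lra.
lra.
Qed.

(** Any bound [exp (o (k ^ 2))] serves in the estimates below; this one follows
    from [k <= exp (2 sqrt k)]. *)
Lemma fact_le_expR (R : realType) (k : nat) :
  k`!%:R <= expR (2 * k%:R * Num.sqrt k%:R) :> R.
Proof.
have fe : (k`! <= k ^ k)%N.
  elim: k => // -[//|k] IH; rewrite factS expnS leq_mul //.
  by rewrite (leq_trans IH) // leq_exp2r.
set y : R := Num.sqrt k%:R.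
have y0 : 0 <= y by apply: sqrtr_ge0.
have ye : y <= expR y by apply: le_trans (expR_ge1Dx y); lra.
have ky : k%:R <= expR (2 * y).
  rewrite mulrC expRM_natr -(@sqr_sqrtr R k%:R) //.
  by rewrite ler_pXn2r ?nnegrE ?expR_ge0.
apply: (@le_trans _ _ (k%:R ^+ k)); first by rewrite -natrX ler_nat.
rewrite mulrAC expRM_natr.
by case: k {fe} y y0 ye ky => // k y y0 ye ky; rewrite ler_pXn2r ?nnegrE ?expR_ge0.
Qed.

(** The term of one round in the union bound, as a single exponential. *)
Lemma round_bound (R : realType) (n k : nat) (delta b t : R) :
  (0 < n)%N -> 0 <= b <= 1 -> 0 <= delta -> delta < 2 ->
  let q := expR ((ln 2 + delta * ln n%:R) / 2) in
  0 <= ln n%:R :> R -> 0 <= t -> 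
  (k.+1)`!%:R * (q ^+ k * (n%:R / q) `^ (k%:R * (surplus b + 2 * Num.sqrt k%:R^-1)))
    / 2 `^ (t * ((k%:R ^+ 2 - k%:R) / 2))
  <= expR (2 * (k%:R + 1) * Num.sqrt (k%:R + 1) + ln 2 / 2 * k%:R
      + k%:R * ln n%:R * f b delta + 2 * Num.sqrt k%:R * ln n%:R
      - ln 2 * t * (k%:R ^+ 2 - k%:R) / 2).
Proof.
move=> n0 b01 d0 d2 q L0 t0; set L := ln n%:R in q L0 *.
have /andP[b0 b1] := b01.
have nE : n%:R = expR L by rewrite lnK // posrE ltr0n.
have l20 : 0 <= ln 2 :> R by rewrite ln_ge0 // ler1n.
set P := k%:R * _.
have e1 : q ^+ k = expR (k%:R * ((ln 2 + delta * L) / 2)) by rewrite expRM_natl.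
have e2 : (n%:R / q) `^ P = expR ((L - (ln 2 + delta * L) / 2) * P).
  by rewrite expRM nE /q expRB.
have e3 : 2 `^ (t * ((k%:R ^+ 2 - k%:R) / 2)) = expR (t * ((k%:R ^+ 2 - k%:R) / 2) * ln 2).
  by rewrite /powR pnatr_eq0.
rewrite e1 e2 e3 -expRD -mulrA -expRB.
apply: (@le_trans _ _ (expR (2 * k.+1%:R * Num.sqrt k.+1%:R) * expR
  (k%:R * ((ln 2 + delta * L) / 2) + (L - (ln 2 + delta * L) / 2) * P
   - t * ((k%:R ^+ 2 - k%:R) / 2) * ln 2))).
  by rewrite ler_wpM2r ?expR_ge0 // fact_le_expR.
rewrite -expRD ler_expR -[k.+1%:R]natr1 f_surplusE //; last exact: ltW.
set s := surplus b; have s0 : 0 <= s by apply: surplus_ge0.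
set K : R := k%:R.
have kk : K * Num.sqrt K^-1 = Num.sqrt K.
  have [->|K0] := eqVneq K 0; first by rewrite mul0r sqrtr0.
  by rewrite -{1}(@sqr_sqrtr _ K) ?ler0n // sqrtrV ?ler0n // expr2 mulfK // sqrtr_eq0 -ltNge lt_def K0 ler0n.
have r0 : 0 <= Num.sqrt K by apply: sqrtr_ge0.
have PE : P = K * s + 2 * Num.sqrt K by rewrite /P mulrDr mulrCA kk.
rewrite PE.
set y := Num.sqrt (K + 1); set r := Num.sqrt K in r0 *.
have K0 : 0 <= K by apply: ler0n.
have Ks : 0 <= K * s by rewrite mulr_ge0.
clearbody y r s K L.
set lam := ln 2 in l20 *.
have g1 : 0 <= lam * (K * s) by rewrite mulr_ge0.
have g2 : 0 <= r * lam by rewrite mulr_ge0.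
have g3 : 0 <= r * (delta * L) by rewrite mulr_ge0 // mulr_ge0.
clear -g1 g2 g3; clearbody lam.
lra.
Qed.

(** * No algorithm beats a profile *)

(** The share of the first [j] rounds. *)
Definition cumulative (R : realType) l (beta : 'rV[R]_l) (j : nat) : R :=
  \sum_(i < l | (i < j)%N) beta 0 i.

Lemma cumulative0 (R : realType) l (beta : 'rV[R]_l) : cumulative beta 0 = 0.
Proof. by rewrite /cumulative big_pred0. Qed.

Lemma cumulative_max (R : realType) l (beta : 'rV[R]_l) :
  simplex beta -> cumulative beta l = 1.
Proof. by case=> _ <-; apply: eq_bigl => i; rewrite ltn_ord. Qed.

Lemma cumulative_itv (R : realType) l (beta : 'rV[R]_l) j :
  simplex beta -> 0 <= cumulative beta j <= 1.
Proof.
case=> b0 b1; rewrite /cumulative sumr_ge0 //= -b1 [X in _ <= X](bigID (fun i : 'I_l => (i < j)%N)) /=.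
by rewrite lerDl sumr_ge0.
Qed.

Lemma tail_cumulative (R : realType) l (beta : 'rV[R]_l) j :
  simplex beta -> \sum_(i < l | (j <= i)%N) beta 0 i = 1 - cumulative beta j.
Proof.
case=> _ <-; rewrite /cumulative [X in _ = X - _](bigID (fun i : 'I_l => (i < j)%N)) /=.
by rewrite addrC addrK; apply: eq_bigl => i; rewrite leqNgt.
Qed.

Lemma Gnp_prob_half_le (R : realType) n (P P' : pred (graph n)) :
  (forall G, P G -> P' G) -> Gnp_prob (2^-1 : R) P <= Gnp_prob (2^-1 : R) P'.
Proof.
move=> PP'; rewrite !Gnp_prob_half ler_wpM2r ?invr_ge0 // ler_nat.
by apply: subset_leq_card; apply/fintype.subsetP => G; rewrite !inE; exact: PP'.
Qed.

(** For [n] large, each of the [l] terms of the union bound is at most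
    [exp (- k)], and [l] times this is less than [1 / 2]. *)
Lemma achievable_le (R : realType) (delta : R) l (beta : 'rV[R]_l) (m alpha : R) :
  1 <= delta < 2 -> simplex beta -> 0 <= m ->
  (forall i : 'I_l, cumulative beta i < 1) ->
  (forall i : 'I_l,
     2 * f (cumulative beta i.+1) delta <= m * (1 - cumulative beta i)) ->
  achievable delta l alpha -> alpha <= m.
Proof.
move=> /andP[d1 d2] sb m0 B1 hf [A near]; rewrite leNgt; apply/negP => ma.
have d0 : 0 <= delta by lra.
have a0 : 0 < alpha by apply: le_lt_trans ma.
pose B := cumulative beta.
have l20 : 0 < ln 2 :> R by rewrite ln_gt0 // ltr1n.
set lam : R := ln 2 in l20 *.
pose X i : R := (lam + 8 + lam / 2 + 4 * lam / alpha + 1)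
    / (lam * (1 - B i) * (1 - m / alpha) / 2).
have X0 (i : 'I_l) : 0 <= X i.
  apply: divr_ge0.
    by rewrite !addr_ge0 ?divr_ge0 ?mulr_ge0 // ?(ltW a0) ?(ltW l20).
  rewrite divr_ge0 // !mulr_ge0 ?(ltW l20) // subr_ge0; first by rewrite ltW // B1.
  by rewrite ler_pdivrMr // mul1r ltW.
(* [X i] is the threshold of [exponent_le] for round [i]; the sum dominates
   all of them. *)
pose Y : R := 1 + \sum_(i < l) X i.
have Y1 : 1 <= Y by rewrite /Y lerDl sumr_ge0.
have XY (i : 'I_l) : X i <= Y.
  rewrite /Y (bigD1 i) //= addrCA lerDl addr_ge0 //.
  by apply: sumr_ge0 => j _; exact: X0.
pose Z : R := Y ^+ 2 + 2 * l%:R.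
(* [ln n >= K0] ensures both [k >= Z] and [q <= n]. *)
pose K0 : R := lam * (Z + 1) / alpha + lam / (2 - delta).
have Z0 : 0 <= Z by rewrite addr_ge0 // ?sqr_ge0 ?mulr_ge0.
have [n [[probes clq prob] hn]] := filter_ex (filterI near (nbhs_infty_ger (expR K0))).
have nR : 0 < n%:R :> R by apply: lt_le_trans hn; exact: expR_gt0.
have n0 : (0 < n)%N by rewrite -(ltr0n R).
set L : R := ln n%:R.
have d20 : 0 < 2 - delta by lra.
have K01 : 0 <= lam * (Z + 1) / alpha.
  by rewrite divr_ge0 ?(ltW a0) // mulr_ge0 ?(ltW l20) //; lra.
have K02 : 0 <= lam / (2 - delta) by rewrite divr_ge0 ?ltW.
have KL : K0 <= L by rewrite -(expRK K0) ler_ln ?posrE ?expR_gt0.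
have L0 : 0 <= L by rewrite /K0 in KL; lra.
pose z := alpha * log2 n%:R.
have zE : z = alpha * L / lam by rewrite /z /log2 mulrA.
have z0 : 0 <= z by rewrite zE divr_ge0 ?(ltW l20) // mulr_ge0 ?(ltW a0).
pose k := Num.truncn z.
have /andP[kz zk] := truncn_itv z0.
rewrite -/k in kz zk.
have Zz : Z + 1 <= z.
  have : lam * (Z + 1) / alpha <= L by apply: le_trans KL; rewrite /K0 lerDl.
  by rewrite zE ler_pdivlMr // ler_pdivrMr // [_ * lam]mulrC [alpha * _]mulrC.
have Zk : Z <= k%:R by move: zk; rewrite -[k.+1%:R]natr1; lra.
have k0 : (0 < k)%N.
  rewrite -(ltr0n R); apply: lt_le_trans Zk; rewrite /Z.
  by rewrite ltr_wpDr ?mulr_ge0 // exprn_gt0 //; lra.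
have kR : 0 <= k%:R :> R by [].
pose x : R := Num.sqrt k%:R.
have x2 : x ^+ 2 = k%:R by rewrite sqr_sqrtr.
have Yx : Y <= x.
  rewrite -(@ler_pXn2r _ 2) ?nnegrE ?sqrtr_ge0 //; last by lra.
  by rewrite x2; apply: le_trans Zk; rewrite /Z lerDl mulr_ge0.
pose q : R := expR ((lam + delta * L) / 2).
have q2 : q ^+ 2 = 2 * n%:R `^ delta.
  rewrite /q -expRM_natr divfK ?pnatr_eq0 // expRD lnK ?posrE //.
  by rewrite /powR pnatr_eq0 eqn0Ngt n0.
have qn : q <= n%:R.
  rewrite -[n%:R](@lnK R) ?posrE // /q ler_expR -/L.
  rewrite ler_pdivrMr //.
  have : lam <= (2 - delta) * L.
    rewrite mulrC -ler_pdivrMr //; apply: le_trans KL; by rewrite /K0 lerDr.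
  lra.
pose C := ((k ^ 2 - k)./2)%N.
have hC (S : {set 'I_n}) : #|S| = k -> #|pairs_in S| = C.
  move=> cS; have := card_pairs_in S; rewrite cS /C => <-.
  by rewrite addnK mul2n doubleK.
pose c i : R := (k.+1)`!%:R *
     (q ^+ k * (n%:R / q) `^ (k%:R * (surplus (B i.+1) + 2 * Num.sqrt k%:R^-1))).
have CE : C%:R = (k%:R ^+ 2 - k%:R) / 2 :> R.
  have e : (C.*2 + k = k ^ 2)%N.
    have kk : (k <= k ^ 2)%N by rewrite -mulnn leq_pmulr.
    have ev : ~~ odd (k ^ 2 - k) by rewrite oddB // oddX orFb addbb.
    by rewrite /C even_halfK // subnK.
  move/(congr1 (fun m : nat => m%:R : R)): e; rewrite natrD -muln2 natrM natrX; lra.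
have := @prob_large_result R n (A n) l k B c C clq hC (cumulative0 _) (cumulative_max sb).
have hc : forall (i : nat) (G : graph n), (i < l)%N ->
     #|[set S : {set 'I_n} | (#|S| == k) &&
        (B i.+1 * C%:R <= #|probed (A n) G i.+1 :&: pairs_in S|%:R)]%SET|%:R <= c i.
  move=> r G rl.
  have := @card_dense_sets R n (probed (A n) G r.+1) q (B r.+1) k k0 (cumulative_itv _ sb) (expR_gt0 _) qn.
  have hq : 2 * #|probed (A n) G r.+1|%:R <= q ^+ 2.
    rewrite q2 ler_pM2l //; apply: le_trans (probes G); rewrite ler_nat.
    apply: leq_trans (card_probed _ _ _).
    by apply: subset_leq_card; exact: probed_mono.
  move=> /(_ hq); apply: le_trans; rewrite ler_nat; apply: subset_leq_card.
  apply/fintype.subsetP => S; rewrite !inE => /andP[/eqP cS]; rewrite cS eqxx /=.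
  by rewrite (hC S cS).
move=> /(_ hc) bound.
have each (i : 'I_l) : c i / 2 `^ ((1 - B i) * C%:R) <= expR (- k%:R).
  have Bi0 : 0 < 1 - B i by rewrite subr_gt0 B1.
  have rb := @round_bound R n k delta (B i.+1) (1 - B i) n0
    (cumulative_itv _ sb) d0 d2 L0 (ltW Bi0).
  rewrite CE; apply: (le_trans rb).
  rewrite ler_expR.
  have /andP[Bi _] := cumulative_itv i sb.
  have /andP[Bj _] := cumulative_itv i.+1 sb.
  have f0 : 0 <= f (B i.+1) delta.
    by apply: f_ge0; rewrite ?cumulative_itv ?d0 ?(ltW d2).
  have := @exponent_le R lam L alpha m (1 - B i) (f (B i.+1) delta) x l20 L0 a0 m0 ma Bi0.
  have -> : x ^+ 4 = k%:R ^+ 2 by rewrite -x2 -exprM.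
  rewrite x2; apply => //.
  - by rewrite gerBl.
  - exact: le_trans Y1 Yx.
  - by rewrite natr1 [lam * _]mulrC -ler_pdivrMr // -zE ltW.
  - by apply: le_trans Yx; exact: XY.
have : 2^-1 <= \sum_(i < l) expR (- k%:R) :> R.
  apply: (le_trans prob); apply: le_trans (Gnp_prob_half_le _ _) _; last first.
    apply: (le_trans bound); apply: ler_sum => i _; exact: each.
  move=> G /= h; rewrite -(ler_nat R); apply: le_trans h.
  exact: kz.
rewrite sumr_const card_ord -[X in _ <= X]mulr_natl expRN ler_pdivlMr ?expR_gt0 //.
have ek := expR_ge1Dx (k%:R : R).
have lk : 2 * l%:R <= k%:R :> R by apply: le_trans Zk; rewrite /Z lerDr sqr_ge0.
clear -ek lk; lra.
Qed.

(** * An explicit profile *)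

Lemma max_ratio_le (R : realType) (delta m : R) l (beta : 'rV[R]_l) :
  simplex beta -> (forall i : 'I_l, cumulative beta i < 1) ->
  (forall i : 'I_l,
     2 * f (cumulative beta i.+1) delta <= m * (1 - cumulative beta i)) ->
  (max_ratio delta beta <= m%:E)%E.
Proof.
move=> sb B1 hf; apply: bigmax_le => [|i _]; first exact: leNye.
have Bi : 0 < 1 - cumulative beta i by rewrite subr_gt0.
rewrite /round_ratio tail_cumulative // gt_eqF // lee_fin ler_pdivrMr //.
exact: hf.
Qed.

(** The linear function agrees with [f] at [0] and at [1]. *)
Lemma f_le_linear (R : realType) (beta delta : R) : 0 <= beta <= 1 -> delta <= 2 ->
  2 * f beta delta <= delta + (2 - delta) * (1 - beta).
Proof.
move=> b01 d2; rewrite f_surplusE //; have /andP[b0 b1] := b01.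
have : surplus beta <= 1 - beta.
  rewrite /surplus ge_max; apply/andP; split.
    have s2 := @sqr_sqrtr _ (1 - beta); rewrite subr_ge0 in s2; have {}s2 := s2 b1.
    have := sqr_ge0 (1 - Num.sqrt (1 - beta)); lra.
  have r2 := sqr_sqrtr b0; have r0 := sqrtr_ge0 beta.
  have r1 : Num.sqrt beta <= 1 by rewrite -sqrtr1 ler_wsqrtr.
  nra.
nra.
Qed.

(** The share of the last [m] rounds when the linear bound of [f_le_linear]
    makes all their ratios equal to [c]. *)
Fixpoint tail_share (R : realType) (delta c : R) (m : nat) : R :=
  if m is m'.+1 then (delta + (2 - delta) * tail_share delta c m') / c else 0.

Lemma tail_shareS (R : realType) (delta c : R) m :
  tail_share delta c m.+1 = (delta + (2 - delta) * tail_share delta c m) / c.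
Proof. by []. Qed.

(** The recurrence has the fixed point [delta / (c - 2 + delta)], which it
    approaches by a factor [(2 - delta) / c >= (2 - delta) / 2] per step. *)
Lemma tail_share_bound (R : realType) (delta c : R) m :
  1 <= delta < 2 -> 0 < c <= 2 ->  2 - delta < c ->
  (c - 2 + delta) * tail_share delta c m <= delta * (1 - ((2 - delta) / 2) ^+ m).
Proof.
move=> /andP[d1 d2] /andP[c0 c2] cd.
elim: m => [|m IH] /=; first by rewrite expr0 mulr0 subrr mulr0.
rewrite mulrA ler_pdivrMr // exprS.
set r := _ ^+ m in IH *; set t := tail_share _ _ _ in IH *.
have r0 : 0 <= r by rewrite exprn_ge0 // divr_ge0; lra.
have : (2 - delta) * ((c - 2 + delta) * t) <= (2 - delta) * (delta * (1 - r)).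
  by rewrite ler_pM2l //; lra.
have : 0 <= (2 - c) * (delta * (2 - delta) * r).
  by rewrite !mulr_ge0 //; lra.
nra.
Qed.

Lemma tail_share_gt0 (R : realType) (delta c : R) m :
  1 <= delta < 2 -> 0 < c -> 0 < tail_share delta c m.+1.
Proof.
move=> /andP[d1 d2] c0; elim: m => [|m IH].
  by rewrite /= mulr0 addr0 divr_gt0 //; lra.
rewrite tail_shareS divr_gt0 //.
have h : 0 < (2 - delta) * tail_share delta c m.+1 by apply: mulr_gt0 IH; lra.
by apply: addr_gt0 h; lra.
Qed.

Lemma tail_share_le (R : realType) (delta c : R) m :
  1 <= delta < 2 -> 0 < c -> tail_share delta c m <= tail_share delta c m.+1.
Proof.
move=> d12 c0; have /andP[d1 d2] := d12; elim: m => [|m IH].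
  by rewrite ltW // tail_share_gt0.
rewrite (tail_shareS _ _ m) (tail_shareS _ _ m.+1).
by rewrite ler_pM2r ?invr_gt0 // lerD2l ler_pM2l //; lra.
Qed.

(** The share left after [i] rounds.  The first round receives the excess
    [1 - tail_share delta c l], which only lowers its ratio. *)
Definition balanced (R : realType) (delta c : R) (l : nat) (i : nat) : R :=
  if i is 0%N then 1 else tail_share delta c (l - i).

Lemma telescoping_cumulative (R : realType) l (T : nat -> R) j : (j <= l)%N ->
  cumulative (\row_(i < l) (T i - T i.+1)) j = T 0%N - T j.
Proof.
move=> jl; rewrite /cumulative.
under eq_bigr do rewrite mxE.
rewrite -(big_ord_widen l (fun i => T i - T i.+1) jl) -(big_mkord xpredT (fun i => T i - T i.+1)).
by rewrite -opprB -(telescope_sumr T (leq0n j)) -sumrN; apply: eq_bigr => i _; rewrite opprB.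
Qed.

Lemma explicit_profile (R : realType) (delta : R) (l : nat) :
  1 <= delta < 2 -> (0 < l)%N ->
  let c := 2 - delta * ((2 - delta) / 2) ^+ l in
  0 < c /\ exists beta : 'rV[R]_l, [/\ simplex beta,
    forall i : 'I_l, cumulative beta i < 1 &
    forall i : 'I_l,
     2 * f (cumulative beta i.+1) delta <= c * (1 - cumulative beta i)].
Proof.
move=> d12 l0; set r := (2 - delta) / 2 => c; have /andP[d1 d2] := d12.
have r0 : 0 < r by rewrite divr_gt0 //; lra.
have r1 : r <= 1 / 2 by rewrite /r; lra.
have rl : r ^+ l <= r.
  by rewrite -(prednK l0) exprS ler_piMr ?exprn_ile1 // ?(ltW r0) //; lra.
have rl0 : 0 < r ^+ l by rewrite exprn_gt0.
have c0 : 0 < c by rewrite /c; nra.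
have c2 : c <= 2 by rewrite /c; nra.
have cd : 2 - delta < c by rewrite /c; nra.
pose T := balanced delta c l.
have Tl : T l = 0 by rewrite /T /balanced -(prednK l0) subnn.
have t1 : tail_share delta c l <= 1.
  have c12 : 0 < c <= 2 by rewrite c0.
  have := tail_share_bound l d12 c12 cd; rewrite -/r.
  have -> : delta * (1 - r ^+ l) = (c - 2 + delta) * 1 by rewrite /c; ring.
  by rewrite ler_pM2l //; lra.
have TS i : (i < l)%N -> T i.+1 <= tail_share delta c (l - i) <= T i.
  move=> il; apply/andP; split.
    by rewrite /T /balanced -[in leRHS](subnSK il) tail_share_le.
  by case: i il => [|i] il; rewrite /T /= ?subn0.
have T0 i : (i < l)%N -> 0 < T i.
  case: i => [|i] il; rewrite /T /=; first by [].
  by rewrite -(subnSK il) tail_share_gt0.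
have T1 i : (i <= l)%N -> 0 <= T i by rewrite leq_eqVlt => /orP[/eqP ->|/T0 /ltW //]; rewrite Tl.
split=> //; exists (\row_(i < l) (T i - T i.+1)).
have cumE j : (j <= l)%N -> cumulative (\row_(i < l) (T i - T i.+1)) j = 1 - T j.
  by move=> jl; rewrite telescoping_cumulative.
have sb : simplex (\row_(i < l) (T i - T i.+1)).
  split=> [j|].
    rewrite mxE subr_ge0; have /andP[h1 h2] := TS j (ltn_ord j); exact: le_trans h1 h2.
  have := cumE l (leqnn l); rewrite Tl subr0 => <-.
  by apply: eq_bigl => i; rewrite ltn_ord.
split=> // i.
  by rewrite cumE ?(ltnW (ltn_ord i)) // ltrBlDr ltrDl T0.
rewrite [in X in _ <= X]cumE ?(ltnW (ltn_ord i)) // opprB addrC subrK.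
apply: le_trans (f_le_linear (cumulative_itv _ sb) (ltW d2)) _.
rewrite cumE // opprB [1 + _]addrC subrK.
have /andP[_ h] := TS i (ltn_ord i).
apply: le_trans (_ : c * tail_share delta c (l - i) <= _); last by rewrite ler_pM2l.
by rewrite -(subnSK (ltn_ord i)) tail_shareS [c * _]mulrC divfK ?lt0r_neq0 //.
Qed.

(** * Existence of an optimal profile *)

(** The ratio of round [i] in a form that is continuous in [beta]. *)
Definition surplus_ratio (R : realType) (delta : R) l (i : nat)
    (beta : 'rV[R]_l) : R :=
  (delta + (2 - delta) * surplus (cumulative beta i.+1)) /
  (1 - cumulative beta i).

Lemma cumulative_continuous (R : realType) l j :
  continuous (fun beta : 'rV[R]_l => cumulative beta j).
Proof.
apply: continuous_big => [|i _].
  exact: add_continuous.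
exact: coord_continuous.
Qed.

Lemma surplus_continuous (R : realType) : continuous (@surplus R).
Proof.
move=> b; apply: (@continuous_max _ _
  (fun b : R => 2 * Num.sqrt (1 - b) - 1) (fun b : R => 1 - Num.sqrt b)).
  apply: cvgB; last exact: cvg_cst.
  apply: cvgM; first exact: cvg_cst.
  apply: (@continuous_comp _ _ _ (fun b : R => 1 - b) Num.sqrt);
    last exact: sqrt_continuous.
  by apply: cvgB; [exact: cvg_cst|exact: cvg_id].
apply: cvgB; [exact: cvg_cst|exact: sqrt_continuous].
Qed.

Lemma surplus_ratio_continuous (R : realType) (delta : R) l i (beta : 'rV[R]_l) :
  cumulative beta i < 1 ->
  {for beta, continuous (@surplus_ratio R delta l i)}.
Proof.
move=> B1.
have num (x : R) : {for x, continuous (fun x : R => delta + (2 - delta) * surplus x)}.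
  apply: cvgD; first exact: cvg_cst.
  by apply: cvgM; [exact: cvg_cst|exact: surplus_continuous].
have den (x : R) : x < 1 -> {for x, continuous (fun x : R => (1 - x)^-1)}.
  move=> x1; have h : {for x, continuous (fun x : R => 1 - x)}.
    by apply: cvgB; [exact: cvg_cst|exact: cvg_id].
  have n0 : 1 - x != 0 by rewrite subr_eq0 gt_eqF.
  exact: (cvgV n0 h).
have cnum := @continuous_comp _ _ _ (fun b : 'rV[R]_l => cumulative b i.+1)
  _ beta (@cumulative_continuous R l i.+1 beta) (num _).
have cden := @continuous_comp _ _ _ (fun b : 'rV[R]_l => cumulative b i)
  _ beta (@cumulative_continuous R l i beta) (den _ B1).
exact: (cvgM cnum cden).
Qed.

Definition max_surplus_ratio (R : realType) (delta : R) l (beta : 'rV[R]_l) : R :=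
  \big[Num.max/0]_(i < l) surplus_ratio delta i beta.

Lemma max_surplus_ratio_continuous (R : realType) (delta : R) l (beta : 'rV[R]_l) :
  (forall i : 'I_l, cumulative beta i < 1) ->
  {for beta, continuous (@max_surplus_ratio R delta l)}.
Proof.
move=> B1.
have [g [gc gE]] : exists g : 'rV[R]_l -> R, {for beta, continuous g} /\
    g =1 fun b => \big[Num.max/0]_(i < l) surplus_ratio delta i b.
  elim: (index_enum _) => [|i s [g [gc gE]]].
    by exists (fun=> 0); split=> [|b]; [exact: cst_continuous|rewrite big_nil].
  exists (fun b => Num.max (surplus_ratio delta i b) (g b)); split=> [|b].
    by apply: (@continuous_max _ _ (surplus_ratio delta i)) gc;
      exact: surplus_ratio_continuous.
  by rewrite big_cons gE.
by have -> : @max_surplus_ratio R delta l = g by apply/funext => b; rewrite gE.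
Qed.

(** The base value [0] of the maximum is harmless as all ratios are
    nonnegative and there is at least one. *)
Lemma max_ratioE (R : realType) (delta : R) l (beta : 'rV[R]_l) :
  1 <= delta < 2 -> (0 < l)%N -> simplex beta -> (forall i : 'I_l, cumulative beta i < 1) ->
  max_ratio delta beta = (max_surplus_ratio delta beta)%:E.
Proof.
move=> /andP[d1 d2] l0 sb B1.
have rE (i : 'I_l) : round_ratio delta beta i = (surplus_ratio delta i beta)%:E.
  rewrite /round_ratio tail_cumulative // gt_eqF ?subr_gt0 //.
  rewrite -/(cumulative beta i.+1) f_surplusE ?cumulative_itv ?(ltW d2) //.
  by congr (_ / _)%:E; field.
have r0 (i : 'I_l) : 0 <= surplus_ratio delta i beta.
  have /andP[_ b1] := cumulative_itv i.+1 sb; have s0 := surplus_ge0 b1.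
  rewrite divr_ge0 ?subr_ge0 ?(ltW (B1 i)) // addr_ge0 ?mulr_ge0 //; lra.
have -> : (max_surplus_ratio delta beta)%:E =
    \big[maxe/0%:E]_(i < l) (surplus_ratio delta i beta)%:E.
  by apply: (big_morph EFin) => // x y; rewrite EFin_max.
rewrite /max_ratio; under eq_bigr do rewrite rE.
apply/eqP; rewrite eq_le; apply/andP; split; apply: bigmax_le.
- exact: leNye.
- by move=> i _; exact: (le_bigmax _ (fun i : 'I_l => (surplus_ratio delta i beta)%:E)).
- apply: le_trans (le_bigmax _ (fun i : 'I_l => (surplus_ratio delta i beta)%:E) (Ordinal l0)).
  by rewrite lee_fin.
- by move=> i _; exact: (le_bigmax _ (fun i : 'I_l => (surplus_ratio delta i beta)%:E)).
Qed.

Lemma cumulative_lt1 (R : realType) l (beta : 'rV[R]_l.+1) :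
  simplex beta -> 0 < beta 0 ord_max -> forall i : 'I_l.+1, cumulative beta i < 1.
Proof.
move=> sb b0 i; rewrite -subr_gt0 -tail_cumulative //.
rewrite (bigD1 ord_max) /=; last by rewrite -ltnS ltn_ord.
by case: sb => nn _; rewrite ltr_pwDl // sumr_ge0.
Qed.

(** All shares sum to [1] and [2 f 1 = delta], so that the last ratio alone
    forces the last share to be at least [delta / c] wherever the maximum is at
    most [c]. *)
Lemma last_round_ratio (R : realType) (delta : R) l (beta : 'rV[R]_l.+1) :
  1 <= delta < 2 -> simplex beta ->
  round_ratio delta beta ord_max =
    if beta 0 ord_max == 0 then +oo%E else (delta / beta 0 ord_max)%:E.
Proof.
move=> /andP[d1 d2] sb; rewrite /round_ratio.
have -> : \sum_(j < l.+1 | (@ord_max l <= j)%N) beta 0 j = beta 0 ord_max.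
  apply: big_pred1 => j /=; rewrite -val_eqE /= eqn_leq.
  by have := ltn_ord j; rewrite ltnS => ->.
have -> : \sum_(j < l.+1 | (j <= @ord_max l)%N) beta 0 j = 1.
  by case: sb => _ <-; apply: eq_bigl => j; rewrite /= -ltnS ltn_ord.
have -> : 2 * f 1 delta = delta.
  rewrite f_surplusE ?lexx ?ler01 ?(ltW d2) // /surplus subrr sqrtr0 sqrtr1.
  have -> : 2 * 0 - 1 = -1 :> R by lra.
  by rewrite subrr max_r ?lerN10 //; lra.
by [].
Qed.

(** The points whose last share is at least [delta / c] form a compact set on
    which the maximum is a continuous function; it contains [beta0], and
    elsewhere the maximum exceeds [c]. *)
Lemma max_ratio_minimum (R : realType) (delta : R) (l : nat) (beta0 : 'rV[R]_l.+1) (c : R) :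
  1 <= delta < 2 -> simplex beta0 -> 0 < c -> (max_ratio delta beta0 <= c%:E)%E ->
  exists beta : 'rV[R]_l.+1, [/\ simplex beta,
    (forall i : 'I_l.+1, cumulative beta i < 1) &
    forall x : 'rV[R]_l.+1, simplex x -> (max_ratio delta beta <= max_ratio delta x)%E].
Proof.
move=> d12 sb0 c0 hc; have /andP[d1 d2] := d12.
have d0 : 0 < delta by lra.
pose K : set 'rV[R]_l.+1 := [set b | simplex b /\ delta / c <= b 0 ord_max].
have outside x : simplex x -> ~ K x -> (c%:E < max_ratio delta x)%E.
  move=> sx nKx; have lt : x 0 ord_max < delta / c.
    by rewrite ltNge; apply/negP => h; apply: nKx.
  apply: lt_le_trans (le_bigmax _ (round_ratio delta x) ord_max).
  rewrite last_round_ratio //; case: eqVneq => [_|n0]; first exact: ltry.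
  have xp : 0 < x 0 ord_max by rewrite lt_def n0; case: sx => ->.
  by rewrite lte_fin ltr_pdivlMr // mulrC -ltr_pdivlMr.
have K0 : K beta0.
  by apply: contrapT => /(outside _ sb0); rewrite ltNge hc.
have Klt x : K x -> forall i : 'I_l.+1, cumulative x i < 1.
  move=> [sx hx]; apply: cumulative_lt1 => //; apply: lt_le_trans hx.
  by rewrite divr_gt0.
have cK : compact K.
  have box := @rV_compact R l.+1 (fun=> `[0, 1]%classic) (fun=> @segment_compact R 0 1).
  pose E1 := [set b : 'rV[R]_l.+1 | cumulative b l.+1 = 1].
  pose E2 := [set b : 'rV[R]_l.+1 | delta / c <= b 0 ord_max].
  have cl1 : closed E1.
    have /continuous_closedP /(_ _ (@closed_eq R 1)) := @cumulative_continuous R l.+1 l.+1.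
    by [].
  have cl2 : closed E2.
    have /continuous_closedP /(_ _ (@closed_ge R (delta / c))) := @coord_continuous R 1 l.+1 0 ord_max.
    by [].
  have := compact_closedI (compact_closedI box cl1) cl2.
  congr compact; apply/seteqP; split=> b /=.
    move=> [[b01 s1] hb]; split=> //; split.
      by move=> j; have := b01 j; rewrite /= in_itv /= => /andP[].
    by rewrite -s1; apply: eq_bigl => i; rewrite ltn_ord.
  move=> [sb hb]; split=> //; split; last exact: cumulative_max.
  move=> j; rewrite /= in_itv /=; case: sb => nn <-; rewrite nn /=.
  by rewrite (bigD1 j) //= lerDl sumr_ge0.
have [b] := @EVT_min_rV R l.+1 (@max_surplus_ratio R delta l.+1) K (ex_intro _ _ K0) cK
  (continuous_in_subspaceT (fun x => fun xK => max_surplus_ratio_continuous (Klt x (set_mem xK)))).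
move=> /set_mem Kb bmin; have [sb _] := Kb.
exists b; split=> //; first exact: Klt.
have ltb x : K x -> (max_ratio delta b <= max_ratio delta x)%E.
  move=> Kx; have [sx _] := Kx.
  rewrite !max_ratioE //; [|exact: Klt|exact: Klt].
  by rewrite lee_fin; apply: bmin; exact/mem_set.
move=> x sx; have [Kx|/(outside _ sx)] := pselect (K x); first exact: ltb.
by move=> /ltW; apply: le_trans; apply: le_trans (ltb _ K0) hc.
Qed.

(** * Upper bounds on the clique size *)

Theorem theorem9 (R : realType) (delta : R) (l : nat)
    (hdelta : 1 <= delta < 2) (hl : (0 < l)%N) :
  [/\ exists2 m : \bar R,
        is_minimum (@simplex R l) (@max_ratio R l delta) m
        & (alpha_star delta l <= m)%E,
      exists2 beta : 'rV[R]_l, simplex beta &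
        (max_ratio delta beta
          <= (2 - delta * ((2 - delta) / 2) ^+ l)%:E)%E
    & (alpha_star delta l <= (2 - delta * ((2 - delta) / 2) ^+ l)%:E)%E].
Proof.
case: l hl => // l hl.
have [c0 [beta0 [sb0 B0 hf0]]] := explicit_profile hdelta hl.
set c := 2 - _ in c0 hf0 *.
have hc : (max_ratio delta beta0 <= c%:E)%E by exact: max_ratio_le.
have upper (beta : 'rV[R]_l.+1) : simplex beta ->
    (forall i : 'I_l.+1, cumulative beta i < 1) ->
    (alpha_star delta l.+1 <= max_ratio delta beta)%E.
  move=> sb B1; rewrite max_ratioE //.
  apply: ub_ereal_sup => _ [alpha ach <-]; rewrite lee_fin.
  have m0 : 0 <= max_surplus_ratio delta beta by exact: bigmax_ge_id.
  apply: (achievable_le hdelta sb m0 B1 _ ach) => i.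
  have Bi : 0 < 1 - cumulative beta i by rewrite subr_gt0.
  rewrite -ler_pdivrMr //.
  apply: le_trans (le_bigmax _ (fun i : 'I_l.+1 => surplus_ratio delta i beta) i).
  have /andP[_ d2] := hdelta.
  rewrite /surplus_ratio f_surplusE ?cumulative_itv ?(ltW d2) //.
  by rewrite le_eqVlt; apply/orP; left; apply/eqP; congr (_ / _); field.
have [b [sb Bb bmin]] := max_ratio_minimum hdelta sb0 c0 hc.
split.
- exists (max_ratio delta b); last exact: upper.
  by split; [exists b|exact: bmin].
- by exists beta0; [exact: sb0|exact: hc].
- by apply: le_trans hc; exact: upper.
Qed.
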